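(* Suppose that $(X,T)$ has the transitively-convex-saturated property and the entropy-dense property. Let $\alpha:M(T,X)\to\mathbb R$ be a continuous function satisfying condition [A.3] and such that $\mathrm{Int}(L_\alpha)\neq\emptyset$. If there is an invariant measure with full support, then the ordered collection $\{QR,\ BR_1,\ BR_2,\ BR_3,\ BR_4,\ BR_5\}$ has full entropy gaps with respect to $I_\alpha\cap Tran$.
   Context: $X$ is a compact metric space with metric $d$ and $T:X\to X$ is continuous. $M(T,X)$ is the set of $T$-invariant Borel probability measures with the weak$^*$ topology; $S_\mu$ is the support of $\mu$ (full support: $S_\mu=X$) and $h_\mu=h_\mu(T)$ its metric entropy. For $x\in X$, $\omega_T(x)$ is the $\omega$-limit set and $M_x$ is the set of weak$^*$ limit points of $\frac1n\sum_{j=0}^{n-1}\delta_{T^jx}$. $Tran=\{x:\omega_T(x)=X\}$. Topological entropy of $E\subseteq X$ (Bowen): let $B_n(x,\varepsilon)=\{y: d(T^jx,T^jy)\le\varepsilon,\ 0\le j\le n-1\}$; $\mathfrak F_n(E,\varepsilon)$ is the collection of finite or countable covers of $E$ by sets $B_m(x,\varepsilon)$ with $m\ge n$; $C(E;t,n,\varepsilon,T)=\inf\{\sum_{B_m(x,\varepsilon)\in\mathcal C}2^{-tm}:\mathcal C\in\mathfrak F_n(E,\varepsilon)\}$; $C(E;t,\varepsilon,T)=\lim_{n}C(E;t,n,\varepsilon,T)$; $h_{top}(E,\varepsilon,T)=\inf\{t\ge0:C(E;t,\varepsilon,T)=0\}$; $h_{top}(T,E)=\lim_{\varepsilon\to0}h_{top}(E,\varepsilon,T)$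 (so $h_{top}(T,\emptyset)=0$). Metric entropy uses the same logarithm base $2$. $T$ is transitively-convex-saturated if for every nonempty compact connected $K\subseteq M(T,X)$ contained in the convex hull of finitely many invariant measures, $G^T_K:=\{x\in Tran:M_x=K\}\neq\emptyset$ and $h_{top}(T,G^T_K)=\inf\{h_\mu(T):\mu\in K\}$. $T$ has the entropy-dense property if for every $\mu\in M(T,X)$, every neighbourhood $G$ of $\mu$ in the space of probability measures on $X$ and every $\eta>0$ there is a closed $T$-invariant set $\Lambda\subseteq X$ such that every $T$-invariant probability measure supported on $\Lambda$ lies in $G$ and $h_{top}(T,\Lambda)>h_\mu-\eta$. Full entropy gaps: an ordered collection $Z_1,\dots,Z_k\subseteq X$ ($k\ge2$) has full entropy gaps with respect to $Y\subseteq X$ if $h_{top}(T,(Z_{i+1}\setminus Z_i)\cap Y)=h_{top}(T,Y)$ for all $1\le i<k$. Recurrence: for $S\subseteq\mathbb N$ the upper density is $\bar d(S)=\limsup_n\frac1n|S\cap\{0,\dots,n-1\}|$ and the Banach upper density is $B^*(S)=\limsup_{|I|\to\infty}|S\cap I|/|I|$ over finite integer intervals $I\subseteq\mathbb N$. For a ball $V_\varepsilon(x)$ let $N(x,V_\varepsilon(x))=\{n\ge1:T^nx\in V_\varepsilon(x)\}$. $BR$ is the set of $x$ such that $N(x,V_\varepsilon(x))$ has positive Banach upper density for every $\varepsilon>0$; $QW$ is the set of $x$ such that it has positive upper density for every $\varepsilon>0$. Let $C_x=\overline{\bigcup_{m\in M_x}S_m}$, and $BR^\#=BR\setminus QW$,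 $W^\#=\{x\in BR^\#:S_\mu=C_x\ \forall\mu\in M_x\}$, $V^\#=\{x\in BR^\#:\exists\mu\in M_x,\ S_\mu=C_x\}$, $S^\#=\{x\in X:\bigcap_{\mu\in M_x}S_\mu\ne\emptyset\}$; $BR_1=W^\#$, $BR_2=V^\#\cap S^\#$, $BR_3=V^\#$, $BR_4=V^\#\cup(BR^\#\cap S^\#)$, $BR_5=BR^\#$. $QR=\{x\in X: M_x\text{ is a singleton}\}$. For continuous $\alpha:M(T,X)\to\mathbb R$: $I_\alpha=\{x:\inf_{\mu\in M_x}\alpha(\mu)<\sup_{\mu\in M_x}\alpha(\mu)\}$; $L_\alpha=[\inf_{\mu\in M(T,X)}\alpha(\mu),\sup_{\mu\in M(T,X)}\alpha(\mu)]$ and $\mathrm{Int}(L_\alpha)$ is its interior. Condition [A.3]: for any $\mu,\nu\in M(T,X)$ with $\alpha(\mu)\neq\alpha(\nu)$, the function $\theta\mapsto\alpha(\theta\mu+(1-\theta)\nu)$ is not constant over any (nondegenerate) subinterval of $[0,1]$. *)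

(* Defs.v *)
From HB Require Import structures.
From mathcomp Require Import all_boot all_order all_algebra.
From mathcomp Require Import all_classical all_reals all_analysis.

Set Implicit Arguments.
Unset Strict Implicit.
Unset Printing Implicit Defensive.
Import Order.TTheory GRing.Theory Num.Theory.
Import numFieldNormedType.Exports.

Local Open Scope classical_set_scope.
Local Open Scope ring_scope.

(* The base point is only there because [measurableType] requires one: a space
   carrying a probability measure is nonempty. *)
#[short(type="pointedMetricType")]
HB.structure Definition PointedMetric (K : numDomainType) :=
  {M of Pointed M & Metric K M}.

Definition borel (R : realType) (X : pointedMetricType R) :=
  g_sigma_algebraType (@open X).

Section BorelProbability.
Variables (R : realType) (X : pointedMetricType R).

(* A library measure is a function on all subsets, unconstrained outside the
   sigma-algebra.  Sending the nonmeasurable sets to 0 makes equality of [bprob]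
   coincide with equality of Borel measures (lemma [bprob_eq]). *)
Record bprob := BProb {
  bprob_val :> probability (borel X) R ;
  bprob_nonmeasurable :
    forall A : set (borel X), ~ measurable A -> bprob_val A = 0%E }.

Lemma bprob_eq (mu nu : bprob) :
  (forall A : set (borel X), measurable A -> mu A = nu A) -> mu = nu.
Proof.
move=> mn.
have e : (mu : set (borel X) -> \bar R) = (nu : set (borel X) -> \bar R).
  apply/funext => A; have [mA|nA] := pselect (measurable A); first exact: mn.
  by rewrite !bprob_nonmeasurable.
case: mu nu e {mn} => [[m cm] hm] [[n cn] hn] /= e.
move: cm hm cn hn; rewrite -{}e => cm hm cn hn.
have ec : cm = cn.
  case: cm cn {hm hn} => [[a1 a2] [a3] [a4] [a5] [a6] [a7] [a8]]
    [[b1 b2] [b3] [b4] [b5] [b6] [b7] [b8]].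
  by rewrite (Prop_irrelevance a1 b1) (Prop_irrelevance a2 b2)
    (Prop_irrelevance a3 b3) (Prop_irrelevance a4 b4)
    (Prop_irrelevance a5 b5) (Prop_irrelevance a6 b6)
    (Prop_irrelevance a7 b7) (Prop_irrelevance a8 b8).
by move: hn; rewrite -ec => hn; congr BProb; exact: Prop_irrelevance.
Qed.

Section Canonical.
Variable m : probability (borel X) R.

Definition borel_restr (A : set (borel X)) : \bar R :=
  if `[< measurable A >] then m A else 0%E.

Lemma borel_restrE A : measurable A -> borel_restr A = m A.
Proof. by rewrite /borel_restr => /asboolT ->. Qed.

Let restr0 : borel_restr set0 = 0%E.
Proof. by rewrite borel_restrE. Qed.

Let restr_ge0 A : (0 <= borel_restr A)%E.
Proof. by rewrite /borel_restr; case: ifP. Qed.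

Let restr_sigma_additive : semi_sigma_additive borel_restr.
Proof.
move=> F mF tF mUF; rewrite borel_restrE//.
rewrite (_ : (fun n => _) = (fun n => \sum_(0 <= i < n) m (F i))%E).
  exact: measure_semi_sigma_additive.
by apply/funext => n; apply: eq_bigr => i _; rewrite borel_restrE.
Qed.

HB.instance Definition _ := isMeasure.Build _ _ _ borel_restr
  restr0 restr_ge0 restr_sigma_additive.

Let restrT : borel_restr setT = 1%E.
Proof. by rewrite borel_restrE// probability_setT. Qed.

HB.instance Definition _ :=
  Measure_isProbability.Build _ _ _ borel_restr restrT.

Let restr_nonmeasurable (A : set (borel X)) :
  ~ measurable A -> borel_restr A = 0%E.
Proof. by rewrite /borel_restr => /asboolF ->. Qed.

Definition to_bprob : bprob := BProb restr_nonmeasurable.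

End Canonical.

HB.instance Definition _ := gen_eqMixin bprob.
HB.instance Definition _ := gen_choiceMixin bprob.

Definition bprob_pairing (mu : bprob) : {ptws continuousType X R -> R} :=
  fun f => \int[mu]_x f x.

HB.instance Definition _ :=
  Topological.copy bprob (initial_topology bprob_pairing).

Definition supp (mu : bprob) : set X :=
  [set x | forall U : set X, open U -> U x -> (0 < mu U)%E].

Lemma mnormalize_mass (m : {measure set (borel X) -> \bar R})
    (P : probability (borel X) R) (r : R) (A : set (borel X)) :
  r != 0 -> m setT = r%:E -> mnormalize m P A = (m A * r^-1%:E)%E.
Proof. by move=> r0 mr; rewrite /mnormalize mr eqe (negbTE r0). Qed.

(* [mnormalize] only serves as a total constructor of probabilities: the measure
   being normalised already has mass 1, see [mixE]. *)
Definition mix (t : {i01 R}) (mu nu : bprob) : bprob :=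
  to_bprob (mnormalize (measure_add (mscale (t%:num)%:nng mu)
                                    (mscale (1 - t%:num)%:nng nu)) mu).

Lemma mixE (t : {i01 R}) (mu nu : bprob) (A : set (borel X)) : measurable A ->
  mix t mu nu A = (t%:num%:E * mu A + (1 - t%:num)%:E * nu A)%E.
Proof.
move=> mA; rewrite [LHS]borel_restrE//.
rewrite [LHS](@mnormalize_mass _ _ 1)//.
  by rewrite invr1 mule1 [LHS]measure_addE.
rewrite [LHS]measure_addE /= /mscale/=.
rewrite [X in (_ * X + _)%E]probability_setT.
rewrite [X in (_ + _ * X)%E]probability_setT.
by rewrite !mule1 -EFinD addrC subrK.
Qed.

Definition convex_hull (n : nat) (nu : 'I_n -> bprob) : set bprob :=
  [set mu | exists w : 'I_n -> R,
     [/\ forall i, 0 <= w i, \sum_i w i = 1 &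
      forall A : set (borel X), measurable A ->
        mu A = (\sum_i (w i)%:E * nu i A)%E]].

End BorelProbability.

Arguments bprob {R} X.

Section Dynamics.
Variables (R : realType) (X : pointedMetricType R) (T : X -> X).
Implicit Types (x y : X) (E Y : set X) (mu nu : bprob X).

Definition invariant_measures : set (bprob X) :=
  [set mu | forall A : set (borel X), measurable A -> mu (T @^-1` A) = mu A].

Definition empirical x (n : nat) : bprob X :=
  to_bprob (mnormalize
    (msum (fun j => \d_(iter j T x : borel X)) n) \d_(x : borel X)).

Lemma empiricalE x n (A : set (borel X)) : measurable A ->
  empirical x n.+1 A = (n.+1%:R^-1 * \sum_(j < n.+1) \1_A (iter j T x))%:E.
Proof.
move=> mA; rewrite [LHS]borel_restrE//.
rewrite [LHS](@mnormalize_mass _ _ _ _ n.+1%:R) ?pnatr_eq0//.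
  by rewrite mulrC EFinM -sumEFin.
rewrite [LHS](eq_bigr (fun=> 1%E)); last by move=> i _; exact: diracT.
by rewrite sumEFin sumr_const card_ord.
Qed.

(* The [n = 0] term is irrelevant for the limit points. *)
Definition limit_measures x : set (bprob X) := cluster (empirical x @ \oo).

Definition omega_limit x : set X := cluster ((fun n => iter n T x) @ \oo).

Definition Tran : set X := [set x | omega_limit x = setT].

Definition finite_partition (k : nat) (P : 'I_k -> set X) : Prop :=
  [/\ forall i, measurable (P i : set (borel X)),
      trivIset setT P & \bigcup_i P i = setT].

Definition itinerary (k : nat) (P : 'I_k -> set X) (n : nat)
    (w : {ffun 'I_n -> 'I_k}) : set X :=
  [set x | forall j : 'I_n, P (w j) (iter j T x)].

Definition log2 (x : R) : R := ln x / ln 2.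

(* [ln 0 = 0], so null atoms contribute 0. *)
Definition partition_entropy mu (k : nat) (P : 'I_k -> set X) (n : nat) : R :=
  - \sum_(w : {ffun 'I_n -> 'I_k})
      (let p := fine (mu (itinerary P w)) in p * log2 p).

Definition metric_entropy mu : \bar R :=
  ereal_sup [set h | exists (k : nat) (P : 'I_k -> set X),
    finite_partition P /\
    h = (limn (fun n => n%:R^-1 * partition_entropy mu P n))%:E].

Definition bowen_ball (n : nat) x (e : R) : set X :=
  [set y | forall j, (j < n)%N -> mdist (iter j T x) (iter j T y) <= e].

(* A cover by Bowen balls is encoded by the set of pairs (order, centre). *)
Definition bowen_covers E (n : nat) (e : R) : set (set (nat * X)) :=
  [set D | [/\ countable D, forall p, D p -> (n <= p.1)%N &
               E `<=` \bigcup_(p in D) bowen_ball p.1 p.2 e]].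

Definition bowen_sum E (t : R) (n : nat) (e : R) : \bar R :=
  ereal_inf [set (\esum_(p in D) (2 `^ (- (t * p.1%:R)))%:E)%E
            | D in bowen_covers E n e].

Definition bowen_content E (t e : R) : \bar R :=
  limn (fun n => bowen_sum E t n e).

Definition htop_scale E (e : R) : \bar R :=
  ereal_inf [set t%:E | t in [set t : R | 0 <= t /\ bowen_content E t e = 0%E]].

Definition htop E : \bar R := lim (htop_scale E e @[e --> 0^'+]).

Definition saturated_set (K : set (bprob X)) : set X :=
  [set x | Tran x /\ limit_measures x = K].

Definition transitively_convex_saturated : Prop :=
  forall K : set (bprob X),
    K !=set0 -> compact K -> connected K -> K `<=` invariant_measures ->
    (exists (n : nat) (nu : 'I_n -> bprob X),
       (forall i, invariant_measures (nu i)) /\ K `<=` convex_hull nu) ->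
    saturated_set K !=set0 /\
    htop (saturated_set K) = ereal_inf [set metric_entropy mu | mu in K].

Definition entropy_dense : Prop :=
  forall mu, invariant_measures mu ->
  forall G : set (bprob X), nbhs mu G ->
  forall eta : R, 0 < eta ->
  exists L : set X,
    [/\ closed L, T @` L `<=` L,
        forall nu, invariant_measures nu -> supp nu `<=` L -> G nu &
        (metric_entropy mu - eta%:E < htop L)%E].

Definition full_entropy_gaps (Z : seq (set X)) Y : Prop :=
  (2 <= size Z)%N /\
  forall i, (i.+1 < size Z)%N ->
    htop ((nth set0 Z i.+1 `\` nth set0 Z i) `&` Y) = htop Y.

Definition count_in (S : set nat) (a l : nat) : nat :=
  (\sum_(a <= i < a + l) `[< S i >])%N.

Definition upper_density (S : set nat) : \bar R :=
  limn_esup (fun n => ((count_in S 0 n)%:R / n%:R)%:E).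

Definition banach_upper_density (S : set nat) : \bar R :=
  ereal_inf [set
    ereal_sup [set ((count_in S I.1 I.2)%:R / I.2%:R)%:E
              | I in [set I : nat * nat | (N <= I.2)%N]]
    | N in [set: nat]].

Definition visits x (U : set X) : set nat :=
  [set n | (1 <= n)%N /\ U (iter n T x)].

Definition BR : set X :=
  [set x | forall e : R, 0 < e ->
    (0 < banach_upper_density (visits x (ball x e)))%E].

Definition QW : set X :=
  [set x | forall e : R, 0 < e ->
    (0 < upper_density (visits x (ball x e)))%E].

Definition measure_center x : set X :=
  closure (\bigcup_(m in limit_measures x) supp m).

Definition BRsharp : set X := BR `\` QW.

Definition Wsharp : set X :=
  [set x | BRsharp x /\
     forall mu, limit_measures x mu -> supp mu = measure_center x].

Definition Vsharp : set X :=
  [set x | BRsharp x /\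
     exists2 mu, limit_measures x mu & supp mu = measure_center x].

Definition Ssharp : set X :=
  [set x | \bigcap_(mu in limit_measures x) supp mu !=set0].

Definition BR1 := Wsharp.
Definition BR2 := Vsharp `&` Ssharp.
Definition BR3 := Vsharp.
Definition BR4 := Vsharp `|` (BRsharp `&` Ssharp).
Definition BR5 := BRsharp.

Definition QR : set X := [set x | exists mu, limit_measures x = [set mu]].

(* Only the values of [alpha] on invariant measures are used. *)

Variable alpha : bprob X -> R.

Definition irregular_set : set X :=
  [set x | inf (alpha @` limit_measures x) < sup (alpha @` limit_measures x)].

Definition alpha_range : set R :=
  [set` `[inf (alpha @` invariant_measures), sup (alpha @` invariant_measures)]].

Definition conditionA3 : Prop :=
  forall mu nu, invariant_measures mu -> invariant_measures nu ->
    alpha mu <> alpha nu ->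
  forall a b : {i01 R}, a%:num < b%:num ->
    ~ exists c : R, forall t : {i01 R},
        a%:num <= t%:num <= b%:num -> alpha (mix t mu nu) = c.

End Dynamics.

(* Main.v *)
(* Fix c < htop(Y), where Y is the intersection of I_alpha and Tran.  Along a
   segment from a measure of entropy above c towards a suitable second measure,
   [A.3] gives three measures of entropy still above c with distinct values of
   alpha.  Entropy density replaces them by closed invariant sets of entropy
   above c, which may be taken pairwise disjoint because their invariant measures
   have distinct alpha-values, and the variational
   principle on each set produces mu_0, mu_1, mu_2 of entropy at
   least c with disjoint supports, through one common finite partition.  By
   concavity of the entropy all convex combinations have entropy at least c, so
   saturation gives htop(G_K) >= c for every continuum K made of segments between
   these measures.
   A transitive point is in BR because of the measure with full support, and it is
   not in QW as soon as C_x <> X, which holds when M_x lives on three disjoint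
   closed invariant sets.  The successive gaps are therefore witnessed by: an inner
   part of [mu_0, mu_1]; the half of it containing mu_0; the whole segment; the
   halves containing mu_0 of [mu_0, mu_1] and [mu_0, mu_2]; and the union of both
   whole segments.
   Weak* limits are ultrafilter limits: the setwise limit of the measures is only
   finitely additive, and it is made countably additive by the Caratheodory
   extension of its inner regularization on open sets. *)
Require Import Defs.
From HB Require Import structures.
From mathcomp Require Import all_boot all_order all_algebra.
From mathcomp Require Import all_classical all_reals all_analysis.
From mathcomp Require Import measurable_realfun ring lra zify.
Set Implicit Arguments.
Unset Strict Implicit.
Unset Printing Implicit Defensive.
Import Order.TTheory GRing.Theory Num.Theory.
Import numFieldNormedType.Exports.
Local Open Scope classical_set_scope.
Local Open Scope ring_scope.

(** * Shannon entropy *)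

(** Metric entropy is a supremum, over partitions, of limits, and is awkward to compare between
    measures. Lower bounds are therefore kept in finite form: [q * c] is at most the entropy of the
    [q]-blocks of one fixed partition, for every [q > 0]. Concavity of Shannon entropy passes such a
    bound to convex combinations, provided that the measures share the partition. This shapes the
    variational principle: it returns a scale [e] at which every partition of diameter at most [e]
    with null boundaries satisfies the bound, so that the partition can be chosen later, with
    boundaries null for three measures at once. Null boundaries are needed because limits of
    measures are controlled by inequalities only, from above on closed sets and from below on open
    ones; equality holds just for sets squeezed between the two. Two measures would do for the first
    three gaps. The third serves to leave [V#]: on two segments issuing from [mu_0] no single
    measure has all three disjoint supports inside its own, whereas [C_x] contains them all. *)

Section shannon.
Variable R : realType.
Implicit Types x y : R.

Lemma ln2_gt0 : 0 < ln 2 :> R.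
Proof. by rewrite ln_gt0// ltr1n. Qed.

(** The inequality [ln z <= z - 1] at [z = y / x]. The correction [(y - x) / ln 2] sums to zero over
    two families of equal total mass, which is how most entropy inequalities below arise. *)
Lemma gibbs x y : 0 <= x -> 0 < y ->
  - (x * log2 x) <= - (x * log2 y) + (y - x) / ln 2.
Proof.
have l2 := ln2_gt0.
rewrite le_eqVlt => /orP[/eqP <-|x0] y0.
  by rewrite !mul0r !oppr0 add0r addr0 divr_ge0// ltW.
rewrite /log2 -subr_ge0.
have -> : - (x * (ln y / ln 2)) + (y - x) / ln 2 - - (x * (ln x / ln 2)) =
  ((y - x) - x * (ln y - ln x)) / ln 2 by ring.
rewrite divr_ge0//; last exact: ltW.
rewrite -ln_div ?posrE// subr_ge0.
have -> : y - x = x * (y / x - 1) by field; rewrite gt_eqF.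
rewrite ler_pM2l//.
have := @le_ln1Dx R (y / x - 1); rewrite addrCA subrr addr0; apply.
have yx : 0 < y / x by rewrite divr_gt0.
by rewrite ltrBrDr addNr.
Qed.

Lemma log2M x y : 0 < x -> 0 < y -> log2 (x * y) = log2 x + log2 y.
Proof. by move=> x0 y0; rewrite /log2 lnM ?posrE// mulrDl. Qed.

Lemma ler_log2 x y : 0 < x -> x <= y -> log2 x <= log2 y.
Proof.
move=> x0 xy; rewrite /log2 ler_pM2r ?invr_gt0 ?ln2_gt0//.
by rewrite ler_ln ?posrE// (lt_le_trans x0).
Qed.

Definition shannon (W : finType) (p : W -> R) : R :=
  - \sum_w p w * log2 (p w).

Lemma shannon_ge0 (W : finType) (p : W -> R) :
  (forall w, 0 <= p w <= 1) -> 0 <= shannon p.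
Proof.
move=> p01; rewrite /shannon -sumrN sumr_ge0// => w _.
have /andP[p0 p1] := p01 w.
rewrite oppr_ge0 mulr_ge0_le0// /log2 mulr_le0_ge0//.
  exact: ln_le0.
by rewrite invr_ge0 ltW// ln2_gt0.
Qed.

(** [gibbs] at [y = 1]. The bound is cruder than [log2 #|W|]; what matters is that it depends on [W]
    alone. *)
Lemma shannon_le_card (W : finType) (p : W -> R) :
  (forall w, 0 <= p w) -> shannon p <= #|W|%:R / ln 2.
Proof.
move=> p0; rewrite /shannon -sumrN mulr_natl -sumr_const ler_sum// => w _.
apply: (le_trans (gibbs (p0 w) ltr01)).
rewrite /log2 ln1 mul0r mulr0 oppr0 add0r -[leRHS]mul1r ler_pM2r ?invr_gt0 ?ln2_gt0//.
by have := p0 w; lra.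
Qed.

Lemma big_prod (U V : finType) (F : U * V -> R) :
  \sum_w F w = \sum_u \sum_v F (u, v).
Proof. by rewrite pair_bigA; apply: eq_bigr => -[]. Qed.

Lemma shannon_fst_le (U V : finType) (p : U * V -> R) :
  (forall u, 0 <= p u) -> shannon (fun u => \sum_v p (u, v)) <= shannon p.
Proof.
move=> p0; rewrite /shannon lerN2.
rewrite big_prod.
apply: ler_sum => u _; rewrite mulr_suml; apply: ler_sum => v _.
have := p0 (u, v); rewrite le_eqVlt => /orP[/eqP <-|puv]; first by rewrite !mul0r.
rewrite ler_pM2l//; apply: ler_log2 => //.
by rewrite (bigD1 v)//= lerDl sumr_ge0.
Qed.

(** [gibbs] against the product of the marginals, which has total mass 1 like [p]. Null pairs are
    treated apart because the product may vanish there. *)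
Lemma shannon_le_marginals (U V : finType) (p : U * V -> R) :
  (forall u, 0 <= p u) -> \sum_u p u = 1 ->
  shannon p <= shannon (fun u => \sum_v p (u, v)) +
               shannon (fun v => \sum_u p (u, v)).
Proof.
move=> p0 p1.
pose a u := \sum_v p (u, v); pose b v := \sum_u p (u, v).
have pe := @big_prod U V.
have a0 u : 0 <= a u by apply: sumr_ge0.
have b0 v : 0 <= b v by apply: sumr_ge0.
have suma : \sum_u a u = 1 by rewrite -p1 pe.
have sumb : \sum_v b v = 1 by rewrite -p1 pe exchange_big.
have key w : - (p w * log2 (p w)) <=
   - (p w * log2 (a w.1)) - p w * log2 (b w.2) + (a w.1 * b w.2 - p w) / ln 2.
  case: w => u v /=.
  have pa : p (u, v) <= a u by rewrite /a (bigD1 v)//= lerDl sumr_ge0.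
  have pb : p (u, v) <= b v by rewrite /b (bigD1 u)//= lerDl sumr_ge0.
  have := p0 (u, v); rewrite le_eqVlt => /orP[/eqP <-|puv].
    rewrite !mul0r !oppr0 !addr0 add0r divr_ge0 ?mulr_ge0//.
    by rewrite ltW// ln2_gt0.
  have au : 0 < a u by exact: lt_le_trans puv pa.
  have bv : 0 < b v by exact: lt_le_trans puv pb.
  apply: (le_trans (gibbs (p0 (u, v)) (mulr_gt0 au bv))).
  by rewrite log2M// mulrDr opprD.
rewrite /shannon -sumrN (le_trans (ler_sum _ (fun w _ => key w)))//.
rewrite big_split/= sumrB/= sumrN -mulr_suml sumrB/= p1.
have -> : \sum_(i : U * V) a i.1 * b i.2 = 1.
  rewrite pe/= -suma; apply: eq_bigr => u _.
  by rewrite -mulr_sumr sumb mulr1.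
rewrite subrr mul0r addr0 lerB//.
  rewrite lerN2 pe; apply: ler_sum => u _ /=.
  by rewrite mulr_suml lexx.
rewrite pe exchange_big/=; apply: ler_sum => v _ /=.
by rewrite mulr_suml lexx.
Qed.

(** Jensen by the tangent at the mean [y]: the weighted corrections [t i * (y - x i)] add up to
    zero. *)
Lemma log2_concave (I : finType) (t x : I -> R) :
  (forall i, 0 <= t i) -> (forall i, 0 <= x i) -> \sum_i t i = 1 ->
  - \sum_i t i * (x i * log2 (x i)) <=
  - ((\sum_i t i * x i) * log2 (\sum_i t i * x i)).
Proof.
move=> t0 x0 t1; set y := \sum_i t i * x i.
have y0 : 0 <= y by apply: sumr_ge0 => i _; exact: mulr_ge0.
move: (y0); rewrite le_eqVlt => /orP[/eqP ye|y1].
  rewrite -ye mul0r oppr0 oppr_le0 sumr_ge0// => i _.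
  have : t i * x i = 0.
    move/esym/eqP: ye; rewrite psumr_eq0/=; last by move=> j _; exact: mulr_ge0.
    by move=> /allP/(_ i); rewrite mem_index_enum => /(_ isT)/eqP.
  by rewrite mulrA => ->; rewrite mul0r.
rewrite -sumrN; under eq_bigr do rewrite -mulrN.
have key i : t i * - (x i * log2 (x i)) <=
    t i * (- (x i * log2 y) + (y - x i) / ln 2).
  by rewrite ler_wpM2l// gibbs.
rewrite (le_trans (ler_sum _ (fun i _ => key i)))//.
have -> : \sum_i t i * (- (x i * log2 y) + (y - x i) / ln 2) =
  \sum_i (t i * x i * (- log2 y - (ln 2)^-1) + t i * (y / ln 2)).
  by apply: eq_bigr => i _; ring.
rewrite big_split/= -!mulr_suml t1 -/y; lra.
Qed.

Lemma shannon_concave (I W : finType) (t : I -> R) (p : I -> W -> R) :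
  (forall i, 0 <= t i) -> (forall i w, 0 <= p i w) -> \sum_i t i = 1 ->
  \sum_i t i * shannon (p i) <= shannon (fun w => \sum_i t i * p i w).
Proof.
move=> t0 p0 t1; rewrite /shannon.
under eq_bigr do rewrite mulrN mulr_sumr.
rewrite sumrN exchange_big/= -!sumrN; apply: ler_sum => w _.
exact: log2_concave.
Qed.

(* At a zero of [q] the logarithm is evaluated at [d] instead, which makes the
   bound affine in [p], hence stable under limits. *)
Lemma shannon_le_affine (W : finType) (p q : W -> R) (d : R) : 0 < d ->
  (forall w, 0 <= p w) -> (forall w, 0 <= q w) ->
  shannon p <= \sum_w (let y := if q w == 0 then d else q w in
                       - (p w * log2 y) + (y - p w) / ln 2).
Proof.
move=> d0 p0 q0; rewrite /shannon -sumrN; apply: ler_sum => w _ /=.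
by apply: gibbs => //; case: eqVneq => // qw; rewrite lt_neqAle eq_sym qw q0.
Qed.

End shannon.

(** Fekete's subadditive lemma. It ensures that the [limn] in [metric_entropy] is a genuine limit,
    to which lower bounds pass. *)
Lemma fekete_cvg (R : realType) (u : nat -> R) :
  (forall n, 0 <= u n) -> (forall m n, u (m + n)%N <= u m + u n) ->
  cvgn (fun n => n%:R^-1 * u n).
Proof.
move=> u0 uD.
pose A := [set n.+1%:R^-1 * u n.+1 | n in [set: nat]].
have hA : has_inf A.
  split; first by exists (1%:R^-1 * u 1), 0.
  by exists 0 => _ [n _ <-]; rewrite mulr_ge0.
have uM q m : u (q * m)%N <= q%:R * u m + u 0.
  elim: q => [|q IH]; first by rewrite mul0n mul0r add0r.
  rewrite mulSn (le_trans (uD _ _))// -natr1 mulrDl mul1r; lra.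
apply/cvg_ex; exists (inf A); apply/cvgrPdist_le => e e0.
have [_ [k _ <-] kl] := inf_adherent (divr_gt0 e0 (ltr0n R 2)) hA.
pose m := k.+1.
(* This dominates [u 0 + u (n %% m)] whatever the remainder. The term [u 0] stays because
   subadditivity does not make it vanish. *)
pose B := u 0 + \sum_(i < m) u i.
have B0 : 0 <= B by rewrite addr_ge0// sumr_ge0.
near=> n.
have n0 : (0 < n)%N by near: n; exact: nbhs_infty_gt.
have n0R : 0 < n%:R :> R by rewrite ltr0n.
have lo : inf A <= n%:R^-1 * u n.
  apply: ge_inf; first by case: hA.
  by exists n.-1 => //; rewrite prednK.
rewrite distrC ger0_norm ?subr_ge0// lerBlDl.
have h1 : u n <= (n %/ m)%:R * u m + B.
  rewrite {1}(divn_eq n m) (le_trans (uD _ _))// /B addrA lerD//.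
  by rewrite (bigD1 (Ordinal (ltn_pmod n (ltn0Sn k))))//= lerDl sumr_ge0.
have h2 : (n %/ m)%:R * u m <= n%:R * (m%:R^-1 * u m).
  rewrite mulrA ler_wpM2r// ler_pdivlMr ?ltr0n// -natrM ler_nat.
  exact: leq_divM.
have h3 : n%:R^-1 * B <= e / 2.
  rewrite mulrC ler_pdivrMr// -ler_pdivrMl ?divr_gt0//.
  near: n; exact: nbhs_infty_ger.
rewrite -(ler_pM2l n0R) mulrA divff ?gt_eqF// mul1r (le_trans h1)//.
rewrite (le_trans (lerD h2 (lexx _)))//.
rewrite -(ler_pM2l (n0R)) mulrA divff ?gt_eqF// mul1r in h3.
have := ltW kl; rewrite -(ler_pM2l n0R) -/m; nra.
Unshelve. all: by end_near. Qed.

(** Compactness of [[a, b]] gives a cluster point, and an ultrafilter converges to each of its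
    cluster points. *)
Lemma ultra_bounded_cvg (R : realType) (I : Type) (F : set_system I) (u : I -> R) (a b : R) :
  UltraFilter F -> (forall i, a <= u i <= b) -> cvg (u @ F).
Proof.
move=> UF uab.
have [|p [_ clp]] := @segment_compact R a b (u @ F) _.
  by apply: (@filterS _ F _ setT) filterT => i _; rewrite /= in_itv/=; exact: uab.
apply/cvg_ex; exists p => B Bp.
have [//|/= nB] := in_ultra_setVsetC (u @^-1` B) UF.
by have [x []] := clp (~` B) B nB Bp.
Qed.

(** * Measures from finitely additive probabilities *)

Section borel_sets.
Variables (R : realType) (X : pointedMetricType R).

Lemma open_borel (A : set X) : open A -> measurable (A : set (borel X)).
Proof. by move=> oA; apply: sub_sigma_algebra. Qed.

Lemma closed_borel (A : set X) : closed A -> measurable (A : set (borel X)).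
Proof.
move=> cA; rewrite -(setCK A); apply: measurableC.
by apply: open_borel; exact: closed_openC.
Qed.

Lemma preimage_borel (T : X -> X) (A : set (borel X)) :
  continuous T -> measurable A -> measurable (T @^-1` A : set (borel X)).
Proof.
move=> cT mA.
have -> : T @^-1` A = setT `&` T @^-1` A by rewrite setTI.
have : measurable_fun setT (T : borel X -> borel X).
  apply: (@measurability _ _ (borel X) (borel X) setT T (@open X)) => //.
  move=> _ [U oU <-]; rewrite setTI; apply: open_borel.
  by move/continuousP : cT; apply.
by move=> mf; exact: mf.
Qed.

End borel_sets.

(* Finitely additive probabilities, such as the setwise limit of a sequence of
   probabilities along an ultrafilter. *)
Record fprob (R : realType) (X : pointedMetricType R) := FProb {
  fprob_val :> set X -> R ;
  fprob_ge0 : forall A : set (borel X), measurable A -> 0 <= fprob_val A ;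
  fprobT : fprob_val setT = 1 ;
  fprobU : forall A B : set (borel X), measurable A -> measurable B ->
    A `&` B = set0 -> fprob_val (A `|` B) = fprob_val A + fprob_val B }.

Section regularization.
Variables (R : realType) (X : pointedMetricType R) (nu : fprob X).
Hypothesis compactX : compact [set: X].
Implicit Types (A U V C : set X).

Lemma fprob0 : nu set0 = 0.
Proof.
have := @fprobU _ _ nu set0 set0 measurable0 measurable0 (setI0 _).
by rewrite setU0 => /eqP; rewrite -[X in X == _]addr0 (inj_eq (addrI _)) => /eqP.
Qed.

Lemma fprobC (A : set (borel X)) : measurable A -> nu (~` A) = 1 - nu A.
Proof.
move=> mA; rewrite -(fprobT nu) -(setUv A) fprobU ?setICr//; last exact: measurableC.
by rewrite addrAC subrr add0r.
Qed.

Lemma le_fprob (A B : set (borel X)) : measurable A -> measurable B ->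
  A `<=` B -> nu A <= nu B.
Proof.
move=> mA mB AB; rewrite -(setDUK AB) fprobU ?lerDl ?setDIK//.
- exact/fprob_ge0/measurableD.
- exact: measurableD.
Qed.

Lemma fprobU_le (A B : set (borel X)) : measurable A -> measurable B ->
  nu (A `|` B) <= nu A + nu B.
Proof.
move=> mA mB; have mBA := measurableD mB mA.
have -> : A `|` B = A `|` (B `\` A).
  by rewrite setUDr setDv setD0.
rewrite fprobU//; last by rewrite setDIK.
by rewrite lerD2l le_fprob//; exact: subDsetl.
Qed.

Definition inner_val U : \bar R :=
  ereal_sup [set (nu C)%:E | C in [set C | closed C /\ C `<=` U]].

Lemma inner_val_ge C U : closed C -> C `<=` U -> ((nu C)%:E <= inner_val U)%E.
Proof. by move=> cC CU; apply: ereal_sup_ubound; exists C. Qed.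

Lemma inner_val_ge0 U : (0 <= inner_val U)%E.
Proof. by have := inner_val_ge closed0 (@sub0set _ U); rewrite fprob0. Qed.

Lemma inner_val_le1 U : (inner_val U <= 1)%E.
Proof.
apply: ge_ereal_sup => _ [C [cC _] <-]; rewrite lee_fin -(fprobT nu).
by apply: le_fprob => //; exact: closed_borel.
Qed.

Lemma le_inner_val U V : U `<=` V -> (inner_val U <= inner_val V)%E.
Proof.
move=> UV; apply: ge_ereal_sup => _ [C [cC CU] <-].
by apply: inner_val_ge => //; exact: subset_trans UV.
Qed.

(** Normality separates the disjoint closed sets [C \ U] and [C \ V] by open sets; removing one or
    the other from [C] leaves the two pieces. *)
Lemma closed_split C U V : closed C -> open U -> open V -> C `<=` U `|` V ->
  exists C1 C2, [/\ closed C1, closed C2, C1 `<=` U, C2 `<=` V & C = C1 `|` C2].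
Proof.
move=> cC oU oV CUV.
have cD W : open W -> closed (C `\` W) 
  by move=> oW; apply: closedI => //; exact: open_closedC.
have CD0 : (C `\` U) `&` (C `\` V) = set0.
  by rewrite -subset0 => x [[/CUV[]]] // ? _ [].
have [G1 [G2 [oO1 oO2 s1 s2 O12]]] := (@normal_openP R X).1
  (@pseudometric_normal R X) _ _ (cD _ oU) (cD _ oV) CD0.
exists (C `\` G1), (C `\` G2); split.
- exact: cD.
- exact: cD.
- by move=> x [Cx nO]; apply: contrapT => nU; exact/nO/s1.
- by move=> x [Cx nO]; apply: contrapT => nV; exact/nO/s2.
- by rewrite -setDIr O12 setD0.
Qed.

Lemma closed_bigsetU_le (U : nat -> set X) n C : (forall i, open (U i)) ->
  closed C -> C `<=` \big[setU/set0]_(i < n) U i ->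
  ((nu C)%:E <= \sum_(0 <= i < n) inner_val (U i))%E.
Proof.
move=> oU; elim: n C => [|n IH] C cC.
  by rewrite big_ord0 subset0 => ->; rewrite big_nil fprob0.
rewrite big_ord_recr/= => CU.
have [|C1 [C2 [cC1 cC2 C1U C2U ->]]] := closed_split cC _ (oU n) CU.
  by apply: (big_ind (@open X)) => //; [exact: open0|exact: openU].
rewrite big_nat_recr//= (@le_trans _ _ (nu C1 + nu C2)%:E)//.
  by rewrite lee_fin; apply: fprobU_le; exact: closed_borel.
by rewrite EFinD leeD//; [exact: IH|exact: inner_val_ge].
Qed.

(** A closed set inside the union is compact, hence inside a finite subunion. This is how finite
    additivity of [nu] yields a countable statement. *)
Lemma inner_val_sigma_subadditive (U : nat -> set X) : (forall i, open (U i)) ->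
  (inner_val (\bigcup_i U i) <= \sum_(i <oo) inner_val (U i))%E.
Proof.
move=> oU; apply: ge_ereal_sup => _ [C [cC CU] <-].
have := subclosed_compact cC compactX (@subsetT _ C).
rewrite compact_cover => /(_ _ setT U (fun i _ => oU i) CU)[D _ CD].
pose N := (\max_(i <- finmap.enum_fset D) i).+1.
apply: (@le_trans _ _ (\sum_(0 <= i < N) inner_val (U i))%E).
  apply: closed_bigsetU_le => // x /CD[i /= iD Uix].
  rewrite -bigcup_mkord; exists i => //=.
  by rewrite ltnS; apply: (@leq_bigmax_seq _ _ xpredT id).
by apply: nneseries_lim_ge => i _ _; exact: inner_val_ge0.
Qed.

(* The compactness proof is a parameter so that the outer measure structure can
   be attached to this function. *)
Definition outer_val of compact [set: X] := fun A : set X =>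
  ereal_inf [set inner_val U | U in [set U | open U /\ A `<=` U]].

Local Notation mu := (outer_val compactX).

Lemma outer_val_le A U : open U -> A `<=` U -> (mu A <= inner_val U)%E.
Proof. by move=> oU AU; apply: ereal_inf_lbound; exists U. Qed.

Lemma outer_val_open U : open U -> mu U = inner_val U.
Proof.
move=> oU; apply/eqP; rewrite eq_le outer_val_le//=.
by apply: le_ereal_inf_tmp => _ [V [oV UV] <-]; exact: le_inner_val.
Qed.

Lemma outer_val0 : mu set0 = 0%E.
Proof.
rewrite outer_val_open; last exact: open0.
apply/eqP; rewrite eq_le inner_val_ge0 andbT.
by apply: ge_ereal_sup => x [C [_]]; rewrite subset0 => -> <-; rewrite fprob0.
Qed.

Lemma outer_val_ge0 A : (0 <= mu A)%E.
Proof. by apply: le_ereal_inf_tmp => _ [U _ <-]; exact: inner_val_ge0. Qed.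

Lemma outer_val_le1 A : (mu A <= 1)%E.
Proof.
apply: (le_trans _ (inner_val_le1 setT)).
by apply: outer_val_le => //; exact: openT.
Qed.

Lemma le_outer_val : {homo mu : A B / A `<=` B >-> (A <= B)%E}.
Proof.
move=> A B AB; apply: le_ereal_inf_tmp => _ [U [oU BU] <-].
by apply: outer_val_le => //; exact: subset_trans BU.
Qed.

Lemma outer_val_fin A : mu A \is a fin_num.
Proof.
by rewrite ge0_fin_numE ?outer_val_ge0// (le_lt_trans (outer_val_le1 _)) ?ltry.
Qed.

Lemma outer_val_approx A (e : R) : 0 < e ->
  exists U, [/\ open U, A `<=` U & (inner_val U <= mu A + e%:E)%E].
Proof.
move=> e0; have [_ [U [oU AU] <-] Ue] := lb_ereal_inf_adherent e0 (outer_val_fin A).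
by exists U; split => //; exact: ltW.
Qed.

Lemma outer_val_sigma_subadditive : sigma_subadditive mu.
Proof.
move=> A; apply/lee_addgt0Pr => e e0.
rewrite (le_trans _ (epsilon_trick _ _ (ltW e0)))//; last first.
  by move=> n; exact: outer_val_ge0.
have /choice[U PU] : forall n, exists U, [/\ open U, A n `<=` U &
    (inner_val U <= mu (A n) + (e / (2 ^ n.+1)%:R)%:E)%E].
  by move=> n; apply: outer_val_approx; rewrite divr_gt0// ltr0n expn_gt0.
apply: (@le_trans _ _ (inner_val (\bigcup_i U i))).
  apply: outer_val_le; first by apply: bigcup_open => i _; have [] := PU i.
  by apply: subset_bigcup => i _; have [] := PU i.
apply: (le_trans (inner_val_sigma_subadditive _)); first by move=> i; have [] := PU i.
by apply: lee_nneseries => i _; [move=> _; exact: inner_val_ge0|have [] := PU i].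
Qed.

HB.instance Definition _ := isOuterMeasure.Build R X mu
  outer_val0 outer_val_ge0 le_outer_val outer_val_sigma_subadditive.

(** In an open [V] containing [A], take a nearly optimal closed [C] inside [V] and [U], then a
    nearly optimal closed [D] inside the open set [V \ C]. They are disjoint, so additivity of [nu]
    bounds the value of [V] from below. *)
Lemma open_caratheodory U : open U -> mu.-caratheodory U.
Proof.
move=> oU; apply: le_caratheodory_measurable => A.
apply: le_ereal_inf_tmp => _ [V [oV AV] <-].
apply/lee_addgt0Pr => e e0; have e20 : 0 < e / 2 by exact: divr_gt0.
have fin W : inner_val W \is a fin_num.
  by rewrite ge0_fin_numE ?inner_val_ge0// (le_lt_trans (inner_val_le1 _)) ?ltry.
have [_ [C [cC CVU] <-] Ce] := ub_ereal_sup_adherent e20 (fin (V `&` U)).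
have [_ [D [cD DVC] <-] De] := ub_ereal_sup_adherent e20 (fin (V `\` C)).
rewrite -/(inner_val _) lteBlDr// in Ce.
rewrite -/(inner_val _) lteBlDr// in De.
have h1 : (mu (A `&` U) <= inner_val (V `&` U))%E.
  by apply: outer_val_le; [exact: openI|exact: setSI].
have h2 : (mu (A `&` ~` U) <= inner_val (V `\` C))%E.
  apply: outer_val_le; first by apply: openI => //; exact: closed_openC.
  by move=> x [/AV Vx nUx]; split => // /CVU[].
have h3 : ((nu C + nu D)%:E <= inner_val V)%E.
  rewrite -fprobU; [|exact: closed_borel|exact: closed_borel|].
    apply: inner_val_ge; first exact: closedU.
    by move=> x [/CVU[]|/DVC[]].
  by rewrite -subset0 => x [Cx /DVC[]].
apply: (le_trans (leeD (le_trans h1 (ltW Ce)) (le_trans h2 (ltW De)))).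
have -> : ((nu C)%:E + (e / 2)%:E + ((nu D)%:E + (e / 2)%:E) =
    (nu C + nu D)%:E + e%:E)%E by rewrite -!EFinD; congr EFin; lra.
exact: leeD.
Qed.

Lemma borel_caratheodory (A : set (borel X)) : measurable A -> mu.-caratheodory A.
Proof.
move: A; apply: (@smallest_sub _ _ _ mu.-caratheodory); last exact: open_caratheodory.
split.
- exact: caratheodory_measurable_set0.
- by move=> A mA; rewrite setTD; exact: caratheodory_measurable_setC.
- by move=> A mA; exact: caratheodory_measurable_bigcup.
Qed.

Definition regular_val : set (borel X) -> \bar R := mu.

Let reg0 : regular_val set0 = 0%E. Proof. exact: outer_val0. Qed.

Let reg_ge0 A : (0 <= regular_val A)%E. Proof. exact: outer_val_ge0. Qed.

Let reg_sigma_additive : semi_sigma_additive regular_val.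
Proof.
move=> F mF tF mUF; rewrite /regular_val.
apply: (@caratheodory_measure_sigma_additive _ _ mu) => //.
- by move=> i; exact: borel_caratheodory.
- exact: borel_caratheodory.
Qed.

HB.instance Definition _ := isMeasure.Build _ _ _ regular_val
  reg0 reg_ge0 reg_sigma_additive.

Let regT : regular_val setT = 1%E.
Proof.
apply/eqP; rewrite eq_le outer_val_le1/= /regular_val outer_val_open; last exact: openT.
by rewrite -(fprobT nu); apply: inner_val_ge => //; exact: closedT.
Qed.

HB.instance Definition _ := Measure_isProbability.Build _ _ _ regular_val regT.

(** The two facts kept about the regularization: the portmanteau inequality on closed sets, and
    approximation of open sets from inside measured by [nu] itself. The first yields weak
    convergence, both together invariance. *)
Lemma fprob_regularize : exists m : bprob X,
  (forall C, closed C -> ((nu C)%:E <= m C)%E) /\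
  (forall U (e : R), open U -> 0 < e ->
     exists C, [/\ closed C, C `<=` U & (m U <= (nu C + e)%:E)%E]).
Proof.
exists (to_bprob regular_val); split=> [C cC|U e oU e0].
  rewrite [leRHS]borel_restrE; last exact: closed_borel.
  by apply: le_ereal_inf_tmp => _ [U [oU CU] <-]; exact: inner_val_ge.
rewrite [in X in exists C, X C]/=.
have fin : inner_val U \is a fin_num.
  by rewrite ge0_fin_numE ?inner_val_ge0// (le_lt_trans (inner_val_le1 _)) ?ltry.
have [_ [C [cC CU] <-] Ce] := ub_ereal_sup_adherent e0 fin.
exists C; split => //; rewrite [leLHS]borel_restrE; last exact: open_borel.
rewrite [leLHS](outer_val_open oU) EFinD.
by rewrite -/(inner_val _) lteBlDr// in Ce; exact: ltW.
Qed.

End regularization.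

(** * Real-valued masses and their limits along ultrafilters *)

Section mass.
Variables (R : realType) (X : pointedMetricType R).
Implicit Types (m : bprob X) (A B : set (borel X)).

Definition mass m (A : set (borel X)) : R := fine (m A).

Lemma massE m A : m A = (mass m A)%:E.
Proof.
have [mA|nA] := pselect (measurable A); last by rewrite /mass bprob_nonmeasurable.
by rewrite fineK// fin_num_measure.
Qed.

Lemma mass_ge0 m A : 0 <= mass m A.
Proof. by rewrite /mass fine_ge0// measure_ge0. Qed.

Lemma massT m : mass m setT = 1.
Proof. by rewrite /mass probability_setT. Qed.

Lemma mass0 m : mass m set0 = 0.
Proof. by rewrite /mass measure0. Qed.

Lemma massU m A B : measurable A -> measurable B -> A `&` B = set0 ->
  mass m (A `|` B) = mass m A + mass m B.
Proof.
move=> mA mB AB; apply: EFin_inj.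
by rewrite EFinD -!massE measureU.
Qed.

Definition fprob_of m : fprob X :=
  FProb (fun A _ => mass_ge0 m A) (massT m) (@massU m).

Lemma le_mass m A B : measurable A -> measurable B -> A `<=` B ->
  mass m A <= mass m B.
Proof. exact: (@le_fprob _ _ (fprob_of m)). Qed.

Lemma mass_le1 m A : mass m A <= 1.
Proof.
have [mA|nA] := pselect (measurable A).
  by rewrite -(massT m) le_mass.
by rewrite /mass bprob_nonmeasurable.
Qed.

Lemma massC m A : measurable A -> mass m (~` A) = 1 - mass m A.
Proof. exact: (@fprobC _ _ (fprob_of m)). Qed.

Lemma massU_le m A B : measurable A -> measurable B ->
  mass m (A `|` B) <= mass m A + mass m B.
Proof. exact: (@fprobU_le _ _ (fprob_of m)). Qed.

Lemma mass_partition (I : finType) m (P : I -> set X) A :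
  (forall i, measurable (P i : set (borel X))) -> measurable A ->
  trivIset setT P -> A `<=` \bigcup_i P i ->
  mass m A = \sum_i mass m (A `&` P i).
Proof.
move=> mP mA tP AP; have AE : A = \bigcup_i (A `&` P i).
  by rewrite -setI_bigcupr; apply/esym/setIidPl.
apply: EFin_inj; rewrite -sumEFin -massE {1}AE measure_fin_bigcup//.
- have -> : [set: I] = [set` index_enum I].
    by apply/seteqP; split => // i _; rewrite /= mem_index_enum.
  rewrite -fsbig_seq ?index_enum_uniq//.
  by apply: eq_bigr => i _; exact: massE.
- exact: finite_finset.
- exact: trivIset_setIl.
- by move=> i _; exact: measurableI.
Qed.

End mass.

Section ultralimit.
Variables (R : realType) (X : pointedMetricType R).
Variables (I : Type) (F : set_system I) (s : I -> bprob X).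
Hypothesis UF : UltraFilter F.

Definition ulim (A : set X) : R := lim (mass (s i) A @[i --> F]).

Lemma ulim_cvg (A : set X) : mass (s i) A @[i --> F] --> ulim A.
Proof.
by apply: (@ultra_bounded_cvg _ _ _ _ 0 1) => i; rewrite mass_ge0 mass_le1.
Qed.

Lemma ulim_ge0 (A : set (borel X)) : measurable A -> 0 <= ulim A.
Proof.
move=> _; apply: limr_ge; first exact: ulim_cvg.
by apply: nearW => i; exact: mass_ge0.
Qed.

Lemma ulimT : ulim setT = 1.
Proof.
apply: cvg_lim => //; under eq_fun do rewrite massT.
exact: cvg_cst.
Qed.

Lemma ulimU (A B : set (borel X)) : measurable A -> measurable B ->
  A `&` B = set0 -> ulim (A `|` B) = ulim A + ulim B.
Proof.
move=> mA mB AB; apply: cvg_lim => //; under eq_fun do rewrite massU//.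
by apply: cvgD; exact: ulim_cvg.
Qed.

Definition ulim_fprob : fprob X := FProb ulim_ge0 ulimT ulimU.

End ultralimit.

(** * Integration and weak convergence *)

Section layer_cake.
Variables (R : realType) (X : pointedMetricType R).
Implicit Types (m : bprob X) (f : X -> R).

Lemma continuous_borel_measurable f : continuous f ->
  measurable_fun setT (f : borel X -> R).
Proof.
move=> /continuousP cf; apply: (measurability _ (RGenOInfty.measurableE R)).
move=> _ [_ [a ->] <-]; rewrite setTI; apply: open_borel; apply: cf.
exact: interval_open.
Qed.

Lemma bounded_integrable m f (M : R) : measurable_fun setT (f : borel X -> R) ->
  (forall x, `|f x| <= M) -> m.-integrable setT (EFin \o f).
Proof.
move=> mf fM; apply: measurable_bounded_integrable => //.
  by rewrite [ltLHS](massE m setT) ltry.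
exists M; split; first exact: num_real.
by move=> x Mx y _ /=; exact: le_trans (fM y) (ltW Mx).
Qed.

Definition level f (k i : nat) : set X := [set x | i.+1%:R / k%:R <= f x].

Lemma closed_level f k i : continuous f -> closed (level f k i).
Proof.
move=> cf; rewrite (_ : level f k i = f @^-1` [set y | i.+1%:R / k%:R <= y])//.
by apply: preimage_closed; [move=> x _; exact: cf|exact: closed_ge].
Qed.

(** A layer-cake sum, below the integral of a [[0, 1]]-valued [f] by at most [1 / k]. It involves
    closed sets only, where the portmanteau inequality applies. *)
Definition layer_sum m f k : R := k%:R^-1 * \sum_(i < k) mass m (level f k i).

Let step f k x : R := k%:R^-1 * \sum_(i < k) \1_(level f k i) x.

Lemma step_bounds f k x : (0 < k)%N -> 0 <= f x <= 1 ->
  step f k x <= f x <= step f k x + k%:R^-1.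
Proof.
move=> k0 /andP[f0 f1]; have k0R : 0 < k%:R :> R by rewrite ltr0n.
(* Exactly [p] of the [k] levels contain [x]. *)
pose p := Num.truncn (f x * k%:R).
have fk0 : 0 <= f x * k%:R by rewrite mulr_ge0// ltW.
have /andP[p1 p2] := truncn_itv fk0.
rewrite -/p in p1 p2.
have -> : step f k x = k%:R^-1 * p%:R.
  rewrite /step; congr (_ * _).
  rewrite (eq_bigr (fun i : 'I_k => ((i < p)%N : nat)%:R : R)); last first.
    move=> i _; rewrite indicE /level; congr (_%:R); congr nat_of_bool.
    by rewrite truncn_gt_nat -ler_pdivrMr//; apply/idP/idP; rewrite inE.
  rewrite -natr_sum; congr (_%:R).
  have pk : (p <= k)%N.
    by rewrite -(ler_nat R) (le_trans p1)// ler_piMl// ltW.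
  rewrite -[RHS]card_ord -sum1_card (big_ord_widen k (fun=> 1%N))//.
  by rewrite [RHS]big_mkcond/=; apply: eq_bigr => i _; case: ltnP.
have -> : k%:R^-1 * p%:R + k%:R^-1 = p.+1%:R / k%:R :> R by rewrite -natr1 mulrDl mul1r mulrC.
by rewrite mulrC ler_pdivrMr// p1 ler_pdivlMr// ltW.
Qed.

Lemma indic_integrable m (A : set (borel X)) : measurable A ->
  m.-integrable setT (EFin \o (\1_A : X -> R)).
Proof.
move=> mA; apply: (@bounded_integrable _ _ 1); first exact: measurable_indic.
by move=> x; rewrite indicE; case: (_ \in _); rewrite ?normr1 ?normr0.
Qed.

Lemma Rintegral_sum m (I : Type) (r : seq I) (g : I -> X -> R) :
  (forall i, m.-integrable setT (EFin \o g i)) ->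
  m.-integrable setT (EFin \o (fun x => \sum_(i <- r) g i x)) /\
  \int[m]_x (\sum_(i <- r) g i x) = \sum_(i <- r) \int[m]_x g i x.
Proof.
move=> ig; elim: r => [|i r [IH1 IH2]].
  under eq_fun do rewrite big_nil; rewrite big_nil; split.
    apply: (@bounded_integrable _ _ 0) => // x; by rewrite normr0.
  by rewrite Rintegral_cst// mul0r.
under eq_fun do rewrite big_cons; rewrite big_cons -IH2; split.
  exact: (integrableD measurableT (ig i) IH1).
by rewrite RintegralD.
Qed.

Lemma step_integral m f k : continuous f ->
  m.-integrable setT (EFin \o step f k) /\ \int[m]_x step f k x = layer_sum m f k.
Proof.
move=> cf; have iA i : m.-integrable setT (EFin \o (\1_(level f k i) : X -> R)).
  by apply: indic_integrable; apply: closed_borel; exact: closed_level.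
have [h1 h2] := Rintegral_sum (index_enum 'I_k) (fun i : 'I_k => iA i).
split.
  exact: (integrableZl measurableT k%:R^-1 h1).
rewrite RintegralZl// h2; congr (_ * _); apply: eq_bigr => i _.
rewrite /Rintegral integral_indic// ?setIT//.
by apply: closed_borel; exact: closed_level.
Qed.

Lemma layer_sum_bounds m f k : (0 < k)%N -> continuous f ->
  (forall x, 0 <= f x <= 1) ->
  layer_sum m f k <= \int[m]_x f x <= layer_sum m f k + k%:R^-1.
Proof.
move=> k0 cf f01; have [h1 h2] := step_integral m k cf.
have fi : m.-integrable setT (EFin \o f).
  apply: (@bounded_integrable _ _ 1); first exact: continuous_borel_measurable.
  by move=> x; have /andP[f0 f1] := f01 x; rewrite ger0_norm.
have ki : m.-integrable setT (EFin \o (fun=> k%:R^-1) : X -> \bar R).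
  by apply: (@bounded_integrable _ _ `|k%:R^-1|).
have kE : \int[m]_x (k%:R^-1 : R) = k%:R^-1 by rewrite Rintegral_cst// -/(mass m setT) massT mulr1.
have -> : layer_sum m f k + k%:R^-1 = \int[m]_x (step f k x + k%:R^-1).
  by rewrite RintegralD// kE h2.
rewrite -h2; apply/andP; split.
  by apply: le_Rintegral => // x _; have /andP[] := step_bounds k0 (f01 x).
apply: le_Rintegral => //; first exact: (integrableD measurableT h1 ki).
by move=> x _; have /andP[] := step_bounds k0 (f01 x).
Qed.

Lemma Rintegral_affine m f (a b : R) : m.-integrable setT (EFin \o f) ->
  \int[m]_x (a * f x + b) = a * \int[m]_x f x + b.
Proof.
move=> fi; rewrite RintegralD//.
- by rewrite RintegralZl// Rintegral_cst// -/(mass m setT) massT mulr1.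
- exact: (integrableZl measurableT a fi).
- by apply: (@bounded_integrable _ _ `|b|).
Qed.

Lemma continuous_integrable m f : compact [set: X] -> continuous f ->
  m.-integrable setT (EFin \o f).
Proof.
move=> cX cf.
have cfT : {within setT, continuous f} by exact: continuous_subspaceT.
have /compact_bounded[M [_ /(_ (M + 1))]] := continuous_compact cfT cX.
rewrite ltrDl => /(_ ltr01) Mf.
apply: (@bounded_integrable _ _ (M + 1)); first exact: continuous_borel_measurable.
by move=> x; apply: Mf; exists x.
Qed.

Lemma continuous_affine01 f : compact [set: X] -> continuous f ->
  exists (g : X -> R) (a b : R), [/\ continuous g, forall x, 0 <= g x <= 1 &
    f = (fun x => a * g x + b)].
Proof.
move=> cX cf.
have cfT : {within setT, continuous f} by exact: continuous_subspaceT.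
have /compact_bounded[M [_ /(_ (`|M| + 1))]] := continuous_compact cfT cX.
have M0 := normr_ge0 M.
have MM : M < `|M| + 1 by rewrite (le_lt_trans (ler_norm M))// ltrDl.
move=> /(_ MM) Mf; set N := `|M| + 1 in Mf.
have N0 : 0 < N by rewrite /N; lra.
exists (fun x => (2 * N)^-1 * (f x + N)), (2 * N), (- N); split.
- move=> x; apply: cvgMl_tmp; apply: cvgD; [exact: cf|exact: cvg_cst].
- move=> x; have : `|f x| <= N by apply: Mf; exists x.
  rewrite ler_norml => /andP[h1 h2]; rewrite mulrC divr_ge0/= ?ler_pdivrMr; lra.
- by apply/funext => x; rewrite mulrA divff ?mul1r ?addrK//; lra.
Qed.

End layer_cake.

Lemma le_filter_lim (R : realType) (I : Type) (F : set_system I) (f g : I -> R)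
  (l l' : R) : ProperFilter F -> f i @[i --> F] --> l -> g i @[i --> F] --> l' ->
  (\forall i \near F, f i <= g i) -> l <= l'.
Proof.
move=> PF fl gl fg; have gfl : g i - f i @[i --> F] --> l' - l by exact: cvgB.
rewrite -subr_ge0 -(cvg_lim _ gfl)//; apply: limr_ge; first exact: cvgP gfl.
by apply: filterS fg => i; rewrite -subr_ge0.
Qed.

(** * Weak* limits along ultrafilters *)

Section weak_convergence.
Variables (R : realType) (X : pointedMetricType R).
Hypothesis compactX : compact [set: X].

Lemma bprob_cvg (I : Type) (F : set_system I) (s : I -> bprob X) (m : bprob X) :
  Filter F -> (forall f : X -> R, continuous f ->
    \int[s i]_x f x @[i --> F] --> \int[m]_x f x) ->
  s i @[i --> F] --> m.
Proof.
move=> FF sm B [_ [[W oW <-] Wm WB]].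
have : (fun i => bprob_pairing (s i)) @ F --> bprob_pairing m.
  apply/cvg_sup => f A [_ [[V oV <-] Vm VA]].
  have cf : continuous f by move: f {V oV Vm A VA} => [f [[cf]]].
  have h := sm f cf V (open_nbhs_nbhs (conj oV Vm)).
  by apply: (@filterS _ F _ _ _ _ h) => i; exact: VA.
move=> /(_ W (open_nbhs_nbhs (conj oW Wm))) h.
by apply: (@filterS _ F _ _ _ _ h) => i; exact: WB.
Qed.

Lemma bprob_cvg01 (I : Type) (F : set_system I) (s : I -> bprob X) (m : bprob X) :
  Filter F -> (forall f : X -> R, continuous f -> (forall x, 0 <= f x <= 1) ->
    \int[s i]_x f x @[i --> F] --> \int[m]_x f x) ->
  s i @[i --> F] --> m.
Proof.
move=> FF sm; apply: bprob_cvg => f cf.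
have [g [a [b [cg g01 ->]]]] := continuous_affine01 compactX cf.
have affE (n : bprob X) : \int[n]_x (a * g x + b) = a * \int[n]_x g x + b.
  by rewrite Rintegral_affine//; exact: continuous_integrable.
rewrite affE (_ : (fun i => _) = (fun i => a * \int[s i]_x g x + b)).
  by apply: cvgD; [apply: cvgMl_tmp; exact: sm|exact: cvg_cst].
by apply/funext => i; exact: affE.
Qed.

(** Portmanteau along an ultrafilter. Integrals of [[0, 1]]-valued functions converge because they
    are bounded; layer sums show that the limit is at most the integral against [m]. *)
Lemma closed_mass_cvg (I : Type) (F : set_system I) (s : I -> bprob X) (m : bprob X) :
  UltraFilter F -> (forall C, closed C -> ulim F s C <= mass m C) ->
  s i @[i --> F] --> m.
Proof.
move=> UF sm.
have icvg (f : X -> R) : continuous f -> (forall x, 0 <= f x <= 1) ->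
    cvg (\int[s i]_x f x @[i --> F]).
  move=> cf f01; apply: (@ultra_bounded_cvg _ _ _ _ 0 1) => i.
  have f0 : 0 <= \int[s i]_x f x.
    by apply: Rintegral_ge0 => x _; have /andP[] := f01 x.
  rewrite f0/= -[leRHS](massT (s i)) -[leRHS]mul1r -Rintegral_cst//.
  apply: le_Rintegral => //; [exact: continuous_integrable| |].
    by apply: continuous_integrable => // x; exact: cvg_cst.
  by move=> x _; have /andP[] := f01 x.
have le (f : X -> R) : continuous f -> (forall x, 0 <= f x <= 1) ->
    lim (\int[s i]_x f x @[i --> F]) <= \int[m]_x f x.
  move=> cf f01; apply/ler_addgt0Pr => e e0.
  have [k] : exists k, (0 < k)%N && (k%:R^-1 <= e).
    exists (Num.truncn e^-1).+1; rewrite /=.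
    by rewrite invf_ple ?posrE// ltW// truncnS_gt.
  move=> /andP[k0 ke].
  have scvg : layer_sum (s i) f k + k%:R^-1 @[i --> F] -->
      k%:R^-1 * \sum_(j < k) ulim F s (level f k j) + k%:R^-1.
    apply: cvgD; last exact: cvg_cst.
    apply: cvgMl_tmp; apply: cvg_big => [|j _]; last exact: ulim_cvg.
    by apply: add_continuous.
  apply: (@le_trans _ _ (k%:R^-1 * \sum_(j < k) ulim F s (level f k j) + k%:R^-1)).
    apply: (le_filter_lim _ (icvg f cf f01) scvg).
    by apply: nearW => i; have /andP[] := layer_sum_bounds (s i) k0 cf f01.
  have /andP[lo _] := layer_sum_bounds m k0 cf f01.
  rewrite lerD//; apply: le_trans lo; rewrite ler_wpM2l ?invr_ge0//.
  by apply: ler_sum => j _; apply: sm; exact: closed_level.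
apply: bprob_cvg01 => f cf f01.
(* The reverse inequality is the same one for [1 - f]. *)
have cf' : continuous (fun x => -1 * f x + 1).
  by move=> x; apply: cvgD; [apply: cvgMl_tmp; exact: cf|exact: cvg_cst].
have f01' x : 0 <= -1 * f x + 1 <= 1 by have /andP[] := f01 x; lra.
suff : lim (\int[s i]_x f x @[i --> F]) = \int[m]_x f x.
  by move=> <-; exact: icvg.
apply/eqP; rewrite eq_le le//=.
have := le _ cf' f01'.
rewrite (_ : (fun i => _) = (fun i => -1 * \int[s i]_x f x + 1)); last first.
  by apply/funext => i; rewrite Rintegral_affine//; exact: continuous_integrable.
rewrite Rintegral_affine//; last exact: continuous_integrable.
rewrite (cvg_lim _ (cvgD (@cvgMl_tmp _ _ _ _ _ (-1) _ (icvg f cf f01)) (cvg_cst _)))//.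
by rewrite lerD2r !mulN1r lerN2.
Qed.

Lemma bprob_ultralimit (I : Type) (F : set_system I) (s : I -> bprob X) :
  UltraFilter F -> exists m : bprob X,
    [/\ forall C, closed C -> ulim F s C <= mass m C,
        forall U (e : R), open U -> 0 < e ->
          exists C, [/\ closed C, C `<=` U & mass m U <= ulim F s C + e] &
        s i @[i --> F] --> m].
Proof.
move=> UF; have [m [mC mU]] := fprob_regularize (ulim_fprob s UF) compactX.
have h C : closed C -> ulim F s C <= mass m C.
  by move=> cC; rewrite -lee_fin -massE; exact: mC.
exists m; split => //; last exact: closed_mass_cvg.
move=> U e oU e0; have [C [cC CU le]] := mU U e oU e0.
by exists C; split => //; rewrite -lee_fin -massE.
Qed.

Lemma open_mass_le_ulim (I : Type) (F : set_system I) (s : I -> bprob X) (m : bprob X) :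
  UltraFilter F -> (forall C, closed C -> ulim F s C <= mass m C) ->
  forall U, open U -> mass m U <= ulim F s U.
Proof.
move=> UF mC U oU; have := mC _ (open_closedC oU).
have mU := open_borel oU.
have /= -> := fprobC (ulim_fprob s UF) mU.
by rewrite massC// lerD2l lerN2.
Qed.

(** A null boundary, expressed by an open and a closed set around [A] with null difference. In this
    form it passes directly to complements, intersections and continuous preimages. *)
Definition continuity_set (m : bprob X) (A : set X) :=
  exists U C, [/\ open U, closed C, U `<=` A, A `<=` C & mass m (C `\` U) = 0].

(** The limit value of [A] lies between those of [U] and [C], hence between [mass m U] and
    [mass m C], which coincide. *)
Lemma continuity_set_ulim (I : Type) (F : set_system I) (s : I -> bprob X) (m : bprob X) :
  UltraFilter F -> (forall C, closed C -> ulim F s C <= mass m C) ->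
  forall A : set (borel X), measurable A -> continuity_set m A ->
  ulim F s A = mass m A.
Proof.
move=> UF mC A mA [U [C [oU cC UA AC CU0]]].
have mU := open_borel oU; have mC' := closed_borel cC.
have CU : mass m C <= mass m U.
  rewrite -[leRHS]addr0 -CU0.
  apply: le_trans (massU_le _ mU (measurableD mC' mU)).
  apply: le_mass => //; first by apply: measurableU => //; exact: measurableD.
  by move=> x Cx; have [Ux|nUx] := pselect (U x); [left|right].
have h1 := le_fprob (ulim_fprob s UF) mU mA UA.
have h2 := le_fprob (ulim_fprob s UF) mA mC' AC.
have h3 := open_mass_le_ulim UF mC oU; have h4 := mC _ cC.
have h5 := le_mass m mU mA UA; have h6 := le_mass m mA mC' AC.
by rewrite /= in h1 h2; lra.
Qed.

End weak_convergence.

(** * Invariance of limit measures *)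

Section invariance.
Variables (R : realType) (X : pointedMetricType R) (T : X -> X).
Hypotheses (compactX : compact [set: X]) (contT : continuous T).

Lemma invariant_mass (m : bprob X) :
  invariant_measures T m <-> forall A : set (borel X), measurable A ->
    mass m (T @^-1` A) = mass m A.
Proof.
split=> [im A mA|im A mA]; first by rewrite /mass im.
by rewrite massE im// -massE.
Qed.

Lemma invariant_measures_open (m : bprob X) :
  (forall U, open U -> mass m (T @^-1` U) = mass m U) -> invariant_measures T m.
Proof.
move=> mT.
have mfT : measurable_fun setT (T : borel X -> borel X).
  by move=> _ A mA; rewrite setTI; exact: preimage_borel.
pose p := measure_function_pushforward__canonical__measure_function_Measure m mfT.
move=> A mA; suff : p A = m A by [].
apply: (@measure_unique _ _ (borel X) (@open X) (fun=> setT) _ _ _ _ p m) => //.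
- exact: openI.
- by move=> _; exact: openT.
- by rewrite bigcup_const.
- move=> V oV; rewrite [RHS]massE -mT// -massE; reflexivity.
- by move=> _; rewrite [ltLHS](massE m setT) ltry.
Qed.

Lemma closed_image (C : set X) : closed C -> closed (T @` C).
Proof.
move=> cC; apply: compact_closed; first exact: metric_hausdorff.
apply: continuous_compact; first exact: continuous_subspaceT.
exact: subclosed_compact cC compactX _.
Qed.

(** Limits are bounded through closed sets only, so each inequality inserts one. For a closed [C] in
    the preimage of [U] it is the image of [C], closed by compactness; for a closed [C] in [U] it is
    the preimage of [C]. *)
Lemma ultralimit_invariant (I : Type) (F : set_system I) (s : I -> bprob X) (m : bprob X)
    (UF : UltraFilter F) :
  (forall C, closed C -> ulim F s C <= mass m C) ->
  (forall U (e : R), open U -> 0 < e ->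
     exists C, [/\ closed C, C `<=` U & mass m U <= ulim F s C + e]) ->
  (forall A : set (borel X), measurable A -> ulim F s (T @^-1` A) = ulim F s A) ->
  invariant_measures T m.
Proof.
move=> mC mU uT; apply: invariant_measures_open => U oU.
have cT A : closed A -> closed (T @^-1` A).
  by move=> cA; apply: preimage_closed => // x _; exact: contT.
have oT : open (T @^-1` U) by apply: open_comp => // x _; exact: contT.
apply/eqP; rewrite eq_le; apply/andP; split; apply/ler_addgt0Pr => e e0.
  have [C [cC CU le]] := mU _ _ oT e0.
  rewrite (le_trans le)// lerD2r.
  have cTC := closed_image cC.
  have sub : C `<=` T @^-1` (T @` C) by move=> x Cx; exists x.
  apply: (@le_trans _ _ (ulim F s (T @^-1` (T @` C)))).
    apply: (le_fprob (ulim_fprob s UF)) sub; apply: closed_borel => //; exact: cT.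
  rewrite uT; last exact: closed_borel.
  apply: (le_trans (mC _ cTC)); apply: le_mass; [exact: closed_borel|exact: open_borel|].
  by move=> _ [x Cx <-]; exact: CU.
have [C [cC CU le]] := mU _ _ oU e0.
rewrite (le_trans le)// lerD2r -uT; last exact: closed_borel.
apply: (le_trans (mC _ (cT _ cC))); apply: le_mass.
- by apply: closed_borel; exact: cT.
- exact: open_borel.
- by move=> x; exact: CU.
Qed.

End invariance.

Section unif.
Variables (R : realType) (X : pointedMetricType R).
Implicit Type s : seq X.

(** Points count with multiplicity, so that concatenated orbit segments give orbit averages. The
    Dirac mass at [point] is a default for the empty list. *)
Definition unif s : bprob X :=
  to_bprob (mnormalize
    (msum (fun j => \d_(nth point s j : borel X)) (size s)) \d_(point : borel X)).

Lemma unif_mass s (A : set (borel X)) : s != [::] -> measurable A ->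
  mass (unif s) A = (size s)%:R^-1 * \sum_(x <- s) \1_A x.
Proof.
move=> s0 mA; have n0 : (size s)%:R != 0 :> R by rewrite pnatr_eq0 size_eq0.
apply: EFin_inj; rewrite -massE [LHS]borel_restrE//.
rewrite [LHS](@mnormalize_mass _ _ _ _ (size s)%:R)//.
  rewrite mulrC EFinM (big_nth point) big_mkord -sumEFin.
  by [].
rewrite [LHS](eq_bigr (fun=> 1%E)); last by move=> i _; exact: diracT.
by rewrite sumEFin sumr_const card_ord.
Qed.

End unif.

(** * Segments of measures and supports *)

Section segment.
Variables (R : realType) (X : pointedMetricType R).
Implicit Types (m n : bprob X) (A : set (borel X)).

(** Truncation makes [segment] total and continuous on the real line, so that arcs of measures
    inherit compactness and connectedness from real intervals. *)
Definition clamp (r : R) : R := Num.max 0 (Num.min r 1).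

Lemma clamp_ge0 r : 0 <= clamp r.
Proof. by rewrite /clamp le_max lexx. Qed.

Lemma clamp_le1 r : clamp r <= 1.
Proof. by rewrite /clamp ge_max ler01/= ge_min lexx orbT. Qed.

Lemma clampK r : 0 <= r <= 1 -> clamp r = r.
Proof. by move=> /andP[r0 r1]; rewrite /clamp min_l// max_r. Qed.

Lemma clamp_continuous : continuous clamp.
Proof.
move=> r.
have c (a : R) : {for r, continuous (fun=> a : R^o)} by exact: cvg_cst.
have ci : {for r, continuous (id : R -> R^o)} by exact: cvg_id.
exact: (continuous_max (c 0) (continuous_min ci (c 1))).
Qed.

Definition segment m n (r : R) : bprob X :=
  mix (Itv01 (clamp_ge0 r) (clamp_le1 r)) m n.

Lemma segment_mass_clamp m n r A : measurable A ->
  mass (segment m n r) A = clamp r * mass m A + (1 - clamp r) * mass n A.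
Proof. by move=> mA; apply: EFin_inj; rewrite -massE mixE//= !massE. Qed.

Lemma segment_mass m n r A : 0 <= r <= 1 -> measurable A ->
  mass (segment m n r) A = r * mass m A + (1 - r) * mass n A.
Proof. by move=> r01 mA; rewrite segment_mass_clamp// clampK. Qed.

Lemma segment_mix m n (t : {i01 R}) : segment m n t%:num = mix t m n.
Proof.
apply: bprob_eq => A mA; rewrite mixE// massE segment_mass//; last by rewrite ge0 le1.
by rewrite !massE.
Qed.

Lemma segment1 m n : segment m n 1 = m.
Proof.
apply: bprob_eq => A mA; rewrite !massE segment_mass// ?ler01 ?lexx//.
by rewrite mul1r subrr mul0r addr0.
Qed.

Lemma segment0 m n : segment m n 0 = n.
Proof.
apply: bprob_eq => A mA; rewrite !massE segment_mass// ?ler01 ?lexx//.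
by rewrite mul0r subr0 mul1r add0r.
Qed.

(** Layer sums are affine in the measure, and [k] is arbitrarily large. *)
Lemma segment_Rintegral m n r (f : X -> R) : continuous f ->
  (forall x, 0 <= f x <= 1) ->
  \int[segment m n r]_x f x =
  clamp r * \int[m]_x f x + (1 - clamp r) * \int[n]_x f x.
Proof.
move=> cf f01; have c0 := clamp_ge0 r; have c1 := clamp_le1 r.
have dist e : 0 < e -> `|\int[segment m n r]_x f x -
    (clamp r * \int[m]_x f x + (1 - clamp r) * \int[n]_x f x)| <= e.
  move=> e0; have [k] : exists k, (0 < k)%N && (k%:R^-1 <= e).
    exists (Num.truncn e^-1).+1; rewrite /=.
    by rewrite invf_ple ?posrE// ltW// truncnS_gt.
  move=> /andP[k0 ke].
  have E : layer_sum (segment m n r) f k =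
      clamp r * layer_sum m f k + (1 - clamp r) * layer_sum n f k.
    rewrite /layer_sum.
    transitivity (k%:R^-1 * (clamp r * (\sum_(i < k) mass m (level f k i)) +
      (1 - clamp r) * \sum_(i < k) mass n (level f k i))); last by ring.
    congr (_ * _); rewrite !mulr_sumr -big_split/=; apply: eq_bigr => i _.
    by apply: segment_mass_clamp; apply: closed_borel; exact: closed_level.
  have /andP[a1 a2] := layer_sum_bounds (segment m n r) k0 cf f01.
  have /andP[b1 b2] := layer_sum_bounds m k0 cf f01.
  have /andP[d1 d2] := layer_sum_bounds n k0 cf f01.
  rewrite E in a1 a2; rewrite ler_norml; nra.
apply/eqP; rewrite -subr_eq0 -normr_le0; apply/ler_addgt0Pr => e e0.
by rewrite add0r dist.
Qed.

Lemma segment_continuous m n : compact [set: X] -> continuous (segment m n).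
Proof.
move=> cX r; apply: bprob_cvg01 => // f cf f01.
rewrite (_ : (fun i => _) = (fun i => clamp i * \int[m]_x f x +
    (1 - clamp i) * \int[n]_x f x)); last first.
  by apply/funext => i; rewrite segment_Rintegral.
rewrite segment_Rintegral//.
apply: cvgD; apply: cvgMr_tmp; first exact: clamp_continuous.
by apply: cvgB; [exact: cvg_cst|exact: clamp_continuous].
Qed.

Lemma segment_image_compact m n a b : compact [set: X] ->
  compact (segment m n @` `[a, b]).
Proof.
move=> cX; apply: continuous_compact; last exact: segment_compact.
by apply: continuous_subspaceT; exact: segment_continuous.
Qed.

Lemma segment_image_connected m n a b : compact [set: X] ->
  connected (segment m n @` `[a, b]).
Proof.
move=> cX; apply: connected_continuous_connected.
  exact: segment_connected.
by apply: continuous_subspaceT; exact: segment_continuous.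
Qed.

Lemma segment_invariant (T : X -> X) m n r : continuous T ->
  invariant_measures T m -> invariant_measures T n ->
  invariant_measures T (segment m n r).
Proof.
move=> cT /invariant_mass im /invariant_mass in_; apply/invariant_mass => A mA.
rewrite !segment_mass_clamp ?im ?in_//; exact: preimage_borel.
Qed.

Lemma supp_mass m x : supp m x <-> forall U : set X, open U -> U x -> 0 < mass m U.
Proof.
by split=> h U oU Ux; have := h U oU Ux; rewrite massE lte_fin.
Qed.

Lemma not_supp m x : ~ supp m x -> exists U, [/\ open U, U x & mass m U = 0].
Proof.
move=> nx; apply: contrapT => h; apply: nx; apply/supp_mass => U oU Ux.
rewrite lt_neqAle mass_ge0 andbT eq_sym; apply/eqP => U0.
by apply: h; exists U.
Qed.

Lemma supp_segment m n r : 0 < r < 1 -> supp (segment m n r) = supp m `|` supp n.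
Proof.
move=> /andP[r0 r1]; have r01 : 0 <= r <= 1 by rewrite !ltW.
apply/seteqP; split => x.
  move/supp_mass => sx; apply: contrapT => /not_orP[nm nn].
  have [U [oU Ux U0]] := not_supp nm.
  have [V [oV Vx V0]] := not_supp nn.
  have := sx (U `&` V) (openI oU oV) (conj Ux Vx).
  have mU := open_borel oU; have mV := open_borel oV.
  rewrite segment_mass//; last exact: measurableI.
  have h1 : mass m (U `&` V) <= 0.
    by rewrite -U0 le_mass//; exact: measurableI.
  have h2 : mass n (U `&` V) <= 0.
    by rewrite -V0 le_mass//; exact: measurableI.
  nra.
have pos U (oU : open U) : mass (segment m n r) U = r * mass m U + (1 - r) * mass n U.
  by rewrite segment_mass//; exact: open_borel.
have sr : 0 < 1 - r by rewrite subr_gt0.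
by case=> /supp_mass sx; apply/supp_mass => U oU Ux; have := sx U oU Ux;
  rewrite pos// => h; have := mass_ge0 m U; have := mass_ge0 n U; nra.
Qed.

Lemma closed_supp m : closed (supp m).
Proof.
rewrite -[supp m]setCK; apply: open_closedC.
rewrite openE => x /= nx.
have [U [oU Ux U0]] := not_supp nx.
apply: filterS (open_nbhs_nbhs (conj oU Ux)) => y Uy.
by move=> /supp_mass /(_ U oU Uy); rewrite U0 ltxx.
Qed.

Lemma supp_sub_closed m (C : set X) : closed C -> mass m C = 1 -> supp m `<=` C.
Proof.
move=> cC C1 x /supp_mass sx; apply: contrapT => nCx.
have := sx (~` C) (closed_openC cC) nCx.
by rewrite massC ?C1 ?subrr ?ltxx//; exact: closed_borel.
Qed.

(** Otherwise [C] would be covered by null open sets, finitely many by compactness, and would be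
    null. *)
Lemma supp_meets_closed m (C : set X) : compact [set: X] -> closed C ->
  0 < mass m C -> (C `&` supp m) !=set0.
Proof.
move=> cX cC C0; apply: contrapT => h.
have nx x : C x -> exists U, [/\ open U, U x & mass m U = 0].
  by move=> Cx; apply: not_supp => sx; apply: h; exists x.
have /choice[f fP] : forall x, exists U, open U /\ (C x -> U x /\ mass m U = 0).
  move=> x.
  have [Cx|nCx] := pselect (C x); last by exists set0; split => //; exact: open0.
  by have [U [oU Ux U0]] := nx x Cx; exists U.
have := subclosed_compact cC cX (@subsetT _ C).
rewrite compact_cover => /(_ _ C f (fun i _ => (fP i).1)) [].
  by move=> x Cx; exists x => //; exact: ((fP x).2 Cx).1.
move=> D DC CD.
have : mass m (\big[setU/set0]_(x <- finmap.enum_fset D) f x) = 0.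
  have : forall x, x \in finmap.enum_fset D -> C x.
    by move=> x xD; have := DC x xD; rewrite inE.
  elim: (finmap.enum_fset D) => [|x r IH] rC; first by rewrite big_nil mass0.
  rewrite big_cons; apply/eqP; rewrite eq_le mass_ge0 andbT.
  apply: le_trans (massU_le _ _ _) _.
  - exact: open_borel (fP x).1.
  - by apply: bigsetU_measurable => i _; exact: open_borel (fP i).1.
  - rewrite ((fP x).2 (rC x _)).2 ?mem_head// add0r IH//.
    by move=> y yr; apply: rC; rewrite in_cons yr orbT.
move=> D0; have := C0; rewrite lt_neqAle => /andP[+ _]; apply/negP; rewrite negbK.
rewrite eq_le mass_ge0/= -D0; apply: le_mass.
- exact: closed_borel.
- by apply: bigsetU_measurable => i _; exact: open_borel (fP i).1.
- by move=> x /CD[i iD fix_]; rewrite -bigcup_seq; exists i.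
Qed.

Lemma supp_nonempty m : compact [set: X] -> supp m !=set0.
Proof.
move=> cX; have [|x [_ sx]] := @supp_meets_closed m setT cX closedT.
  by rewrite massT.
by exists x.
Qed.

Lemma supp_forward (T : X -> X) m : continuous T -> invariant_measures T m ->
  forall x, supp m x -> supp m (T x).
Proof.
move=> cT /invariant_mass im x /supp_mass sx; apply/supp_mass => U oU UTx.
rewrite -im; last exact: open_borel.
apply: sx => //; apply: open_comp => // y _; exact: cT.
Qed.

End segment.

Lemma shannon_reindex (R : realType) (U V : finType) (h : U -> V) (p : V -> R) :
  bijective h -> shannon p = shannon (p \o h).
Proof.
by move=> bh; rewrite /shannon (reindex h)//; exact: onW_bij.
Qed.

(** * Block entropies *)

Section block_entropy.
Variables (R : realType) (X : pointedMetricType R) (T : X -> X).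
Hypothesis contT : continuous T.

Lemma iter_continuous n : continuous (iter n T).
Proof.
elim: n => [|n IH] x /=; first exact: cvg_id.
by apply: continuous_comp; [exact: IH|exact: contT].
Qed.

Lemma iter_preimage_borel n (A : set (borel X)) : measurable A ->
  measurable (iter n T @^-1` A : set (borel X)).
Proof. by move=> mA; apply: preimage_borel => //; exact: iter_continuous. Qed.

Lemma invariant_mass_iter (m : bprob X) n (A : set (borel X)) :
  invariant_measures T m -> measurable A -> mass m (iter n T @^-1` A) = mass m A.
Proof.
move=> im mA; elim: n => [//|n IH].
have -> : iter n.+1 T @^-1` A = T @^-1` (iter n T @^-1` A).
  by apply/funext => x; rewrite /= -iterSr.
by have /invariant_mass -> := im; [exact: IH|exact: iter_preimage_borel].
Qed.

Section partition.
Variables (k : nat) (P : 'I_k -> set X).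
Hypothesis partP : finite_partition P.
Implicit Types (m : bprob X) (p q n a b : nat).

Lemma itinerary_borel n (w : {ffun 'I_n -> 'I_k}) :
  measurable (itinerary T P w : set (borel X)).
Proof.
have [mP _ _] := partP.
have -> : itinerary T P w = \bigcap_(j in [set: 'I_n]) (iter j T @^-1` P (w j)).
  by apply/seteqP; split => x h j; [move=> _; exact: h|exact: h j I].
apply: fin_bigcap_measurable => //.
by move=> j _; exact: iter_preimage_borel.
Qed.

Lemma itinerary_trivIset n : trivIset setT (fun w : {ffun 'I_n -> 'I_k} => itinerary T P w).
Proof.
have [_ tP _] := partP.
move=> w w' _ _ [x [xw xw']]; apply/ffunP => j; apply: tP => //.
by exists (iter j T x).
Qed.

Lemma itinerary_cover n : \bigcup_(w in [set: {ffun 'I_n -> 'I_k}]) itinerary T P w = setT.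
Proof.
have [_ _ cP] := partP; apply/seteqP; split => // x _.
have /choice[c cc] : forall y, exists i, P i y.
  move=> y; have : setT y by [].
  by rewrite -cP => -[i _]; exists i.
exists [ffun j : 'I_n => c (iter j T x)] => // j.
by rewrite ffunE.
Qed.

Lemma preimage_itinerary_trivIset p n : trivIset setT
  (fun w : {ffun 'I_n -> 'I_k} => iter p T @^-1` itinerary T P w).
Proof.
move=> w w' _ _ [x [xw xw']]; apply: (@itinerary_trivIset n) => //.
by exists (iter p T x).
Qed.

Lemma preimage_itinerary_cover p n :
  \bigcup_(w in [set: {ffun 'I_n -> 'I_k}]) (iter p T @^-1` itinerary T P w) = setT.
Proof. by rewrite -preimage_bigcup itinerary_cover preimage_setT. Qed.

(** The entropy of the symbols at the times [p, ..., p + n - 1]. The offset [p] is explicit because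
    Misiurewicz's inequality is applied to measures that need not be invariant. *)
Definition block_entropy m p n : R :=
  shannon (fun w : {ffun 'I_n -> 'I_k} => mass m (iter p T @^-1` itinerary T P w)).

Lemma partition_entropyE m n : partition_entropy T m P n = block_entropy m 0 n.
Proof. by []. Qed.

Lemma block_entropy_ge0 m p n : 0 <= block_entropy m p n.
Proof. by apply: shannon_ge0 => w; rewrite mass_ge0 mass_le1. Qed.

Lemma block_entropy_le m p n : block_entropy m p n <= #|{ffun 'I_n -> 'I_k}|%:R / ln 2.
Proof. by apply: shannon_le_card => w; exact: mass_ge0. Qed.

Lemma block_entropy_invariant m p n : invariant_measures T m ->
  block_entropy m p n = block_entropy m 0 n.
Proof.
move=> im; rewrite /block_entropy; congr shannon; apply/funext => w.
by rewrite !invariant_mass_iter//; exact: itinerary_borel.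
Qed.

Definition ffun_cat a b (uv : {ffun 'I_a -> 'I_k} * {ffun 'I_b -> 'I_k}) :
    {ffun 'I_(a + b) -> 'I_k} :=
  [ffun i => match fintype.split i with inl j => uv.1 j | inr j => uv.2 j end].

Lemma ffun_cat_bij a b : bijective (@ffun_cat a b).
Proof.
exists (fun w : {ffun 'I_(a + b) -> 'I_k} =>
  ([ffun i => w (lshift b i)], [ffun j => w (rshift a j)])).
  move=> [u v]; congr pair; apply/ffunP => i; rewrite !ffunE/=.
    by have := unsplitK (inl i : 'I_a + 'I_b) => /= ->.
  by have := unsplitK (inr i : 'I_a + 'I_b) => /= ->.
move=> w; apply/ffunP => i; rewrite !ffunE.
by case: split_ordP => j ->; rewrite /= ffunE.
Qed.

Lemma itinerary_cat a b (u : {ffun 'I_a -> 'I_k}) (v : {ffun 'I_b -> 'I_k}) p :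
  iter p T @^-1` itinerary T P (ffun_cat (u, v)) =
  (iter p T @^-1` itinerary T P u) `&` (iter (p + a) T @^-1` itinerary T P v).
Proof.
have shift x j : iter j T (iter (p + a) T x) = iter (a + j) T (iter p T x).
  by rewrite -!iterD; congr iter; lia.
apply/seteqP; split => x /=.
  move=> h; split => j.
    have := h (lshift b j); rewrite ffunE.
    by have := unsplitK (inl j : 'I_a + 'I_b) => /= ->.
  have := h (rshift a j); rewrite ffunE shift.
  by have := unsplitK (inr j : 'I_a + 'I_b) => /= ->.
move=> [hu hv] i; rewrite ffunE; case: split_ordP => j ->; first exact: hu.
by have := hv j; rewrite shift.
Qed.

Lemma block_entropy_joint m p a b : block_entropy m p (a + b) =
  shannon (fun uv : {ffun 'I_a -> 'I_k} * {ffun 'I_b -> 'I_k} =>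
    mass m ((iter p T @^-1` itinerary T P uv.1) `&`
            (iter (p + a) T @^-1` itinerary T P uv.2))).
Proof.
rewrite /block_entropy (shannon_reindex _ (ffun_cat_bij a b)).
by congr shannon; apply/funext => -[u v]; rewrite /= itinerary_cat.
Qed.

Lemma block_marginal1 m p a b (u : {ffun 'I_a -> 'I_k}) :
  \sum_(v : {ffun 'I_b -> 'I_k}) mass m ((iter p T @^-1` itinerary T P u) `&`
            (iter (p + a) T @^-1` itinerary T P v)) =
  mass m (iter p T @^-1` itinerary T P u).
Proof.
rewrite [RHS](@mass_partition _ _ _ m
    (fun v : {ffun 'I_b -> 'I_k} => iter (p + a) T @^-1` itinerary T P v))//.
- by move=> v; apply: iter_preimage_borel; exact: itinerary_borel.
- by apply: iter_preimage_borel; exact: itinerary_borel.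
- exact: preimage_itinerary_trivIset.
- by rewrite preimage_itinerary_cover.
Qed.

Lemma block_marginal2 m p a b (v : {ffun 'I_b -> 'I_k}) :
  \sum_(u : {ffun 'I_a -> 'I_k}) mass m ((iter p T @^-1` itinerary T P u) `&`
            (iter (p + a) T @^-1` itinerary T P v)) =
  mass m (iter (p + a) T @^-1` itinerary T P v).
Proof.
under eq_bigr do rewrite setIC.
rewrite [RHS](@mass_partition _ _ _ m
    (fun u : {ffun 'I_a -> 'I_k} => iter p T @^-1` itinerary T P u))//.
- by move=> u; apply: iter_preimage_borel; exact: itinerary_borel.
- by apply: iter_preimage_borel; exact: itinerary_borel.
- exact: preimage_itinerary_trivIset.
- by rewrite preimage_itinerary_cover.
Qed.

Lemma block_sum m p n : \sum_(w : {ffun 'I_n -> 'I_k})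
  mass m (iter p T @^-1` itinerary T P w) = 1.
Proof.
rewrite -(massT m) [RHS](@mass_partition _ _ _ m
    (fun w : {ffun 'I_n -> 'I_k} => iter p T @^-1` itinerary T P w))//.
- by apply: eq_bigr => w _; rewrite setTI.
- by move=> w; apply: iter_preimage_borel; exact: itinerary_borel.
- exact: preimage_itinerary_trivIset.
- by rewrite preimage_itinerary_cover.
Qed.

Lemma block_entropyD m p a b :
  block_entropy m p (a + b) <= block_entropy m p a + block_entropy m (p + a) b.
Proof.
rewrite block_entropy_joint.
apply: le_trans (shannon_le_marginals _ _) _ => [w||].
- exact: mass_ge0.
- rewrite big_prod /=; under eq_bigr do rewrite block_marginal1.
  exact: block_sum.
- rewrite /block_entropy le_eqVlt; apply/orP; left; apply/eqP.
  by congr (_ + _); congr shannon; apply/funext => w /=;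
    [exact: block_marginal1|exact: block_marginal2].
Qed.

Lemma block_entropy_monotone m p a b :
  block_entropy m p a <= block_entropy m p (a + b).
Proof.
rewrite block_entropy_joint; apply: le_trans (shannon_fst_le _) => [|w].
  rewrite /block_entropy le_eqVlt; apply/orP; left; apply/eqP.
  by congr shannon; apply/funext => w /=; rewrite block_marginal1.
exact: mass_ge0.
Qed.

Lemma block_entropy0 m p : block_entropy m p 0 <= 0.
Proof.
rewrite /block_entropy /shannon oppr_le0 sumr_ge0// => w _.
have -> : itinerary T P w = setT by apply/seteqP; split => // x _ [].
by rewrite preimage_setT massT /log2 ln1 mul0r mulr0.
Qed.

(** Invariance removes the offset in the subadditivity of block entropies, so Fekete's lemma
    applies; the supremum over partitions is then bounded below by this one. *)
Lemma metric_entropy_ge m (c : R) : invariant_measures T m ->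
  (forall q, (0 < q)%N -> q%:R * c <= partition_entropy T m P q) ->
  (c%:E <= metric_entropy T m)%E.
Proof.
move=> im hc; apply: le_ereal_sup_tmp.
exists (limn (fun n => n%:R^-1 * partition_entropy T m P n))%:E.
  by exists k, P.
rewrite lee_fin; apply: limr_ge.
  apply: fekete_cvg => [n|a b]; first by rewrite partition_entropyE block_entropy_ge0.
  rewrite !partition_entropyE (le_trans (block_entropyD _ _ _ _))//.
  by rewrite lerD2l block_entropy_invariant.
near=> n; have n0 : (0 < n)%N by near: n; exact: nbhs_infty_gt.
by rewrite -ler_pdivrMl ?invr_gt0 ?ltr0n// invrK hc.
Unshelve. all: by end_near. Qed.

Lemma partition_entropy_segment m (n : bprob X) (r : R) q : 0 <= r <= 1 ->
  r * partition_entropy T m P q + (1 - r) * partition_entropy T n P q <=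
  partition_entropy T (segment m n r) P q.
Proof.
move=> /[dup] r01 /andP[r0 r1]; rewrite !partition_entropyE.
pose t (b : bool) := if b then r else 1 - r.
have t0 (b : bool) : 0 <= t b by case: b; rewrite /t ?subr_ge0.
have t1 : \sum_b t b = 1 by rewrite big_bool/= addrC subrK.
have := shannon_concave t0 (fun (b : bool) w => mass_ge0 (if b then m else n)
  (itinerary T P (w : {ffun 'I_q -> 'I_k}))) t1.
rewrite !big_bool/= => /le_trans; apply.
rewrite le_eqVlt; apply/orP; left; apply/eqP; congr shannon.
apply/funext => w; rewrite big_bool/= segment_mass//.
exact: itinerary_borel.
Qed.

Lemma block_entropy_chop m p q M :
  block_entropy m p (M * q) <= \sum_(i < M) block_entropy m (p + i * q) q.
Proof.
elim: M p => [|M IH] p; first by rewrite big_ord0 mul0n block_entropy0.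
rewrite mulSn (le_trans (block_entropyD _ _ _ _))// big_ord_recl/= mul0n addn0.
rewrite lerD2l (le_trans (IH _))// le_eqVlt; apply/orP; left; apply/eqP.
by apply: eq_bigr => i _; rewrite /= /bump/= mulnDl mul1n addnA.
Qed.

Lemma sum_residues (f : nat -> R) q M :
  \sum_(s < q) \sum_(i < M) f (s + i * q)%N = \sum_(j < M * q) f j.
Proof.
rewrite exchange_big/=; elim: M => [|M IH]; first by rewrite !big_ord0.
rewrite big_ord_recr/= IH.
have -> : \sum_(j < M.+1 * q) f j = \sum_(0 <= j < M * q + q) f j.
  by rewrite big_mkord mulSn addnC.
rewrite (big_cat_nat (leq0n _) (leq_addr q (M * q)))/= !big_mkord; congr (_ + _).
rewrite -[X in _ = \sum_(X <= _ < _) _]add0n big_addn addKn big_mkord.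
by apply: eq_bigr => i _.
Qed.

(* The inequality of Misiurewicz: each of the [q] residues modulo [q] chops the
   long block into blocks of length [q], up to an error independent of [M]. *)
Lemma block_entropy_averaging (sigma nu : bprob X) q M : (0 < q)%N -> (0 < M)%N ->
  (forall A : set (borel X), measurable A ->
    mass nu A = (M * q)%:R^-1 * \sum_(j < M * q) mass sigma (iter j T @^-1` A)) ->
  q%:R * block_entropy sigma 0 (M * q) <=
  \sum_(s < q) #|{ffun 'I_s -> 'I_k}|%:R / ln 2 + (M * q)%:R * block_entropy nu 0 q.
Proof.
move=> q0 M0 nuE; set n := (M * q)%N.
have n0 : 0 < n%:R :> R by rewrite ltr0n muln_gt0 M0.
(* Lengthening the block to [s + n] only raises the entropy. Its first [s] symbols are split off at
   bounded cost and the other [n] are cut into blocks of length [q]. *)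
have step (s : 'I_q) : block_entropy sigma 0 n <=
    #|{ffun 'I_s -> 'I_k}|%:R / ln 2 + \sum_(i < M) block_entropy sigma (s + i * q) q.
  rewrite (le_trans (block_entropy_monotone sigma 0 n s))// addnC.
  rewrite (le_trans (block_entropyD _ _ _ _))// lerD ?block_entropy_le//.
  exact: block_entropy_chop.
have := ler_sum (index_enum 'I_q) (fun s (_ : xpredT s) => step s).
rewrite sumr_const card_ord mulr_natl => /le_trans; apply.
rewrite big_split/= lerD2l (sum_residues (fun p => block_entropy sigma p q)) -/n.
rewrite -ler_pdivrMl//.
(* With equal weights [1 / n], concavity bounds the average of the shifted block entropies by the
   block entropy of the averaged measure [nu]. *)
have t1 : \sum_(j < n) (n%:R^-1 : R) = 1.
  by rewrite sumr_const card_ord -[LHS]mulr_natl divff// gt_eqF.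
have t0 (j : 'I_n) : 0 <= n%:R^-1 :> R by rewrite invr_ge0 ltW.
have := shannon_concave t0 (fun (j : 'I_n) w => mass_ge0 sigma
  (iter j T @^-1` itinerary T P (w : {ffun 'I_q -> 'I_k}))) t1.
rewrite mulr_sumr => /le_trans; apply.
rewrite le_eqVlt; apply/orP; left; apply/eqP; congr shannon.
apply/funext => w; rewrite preimage_id nuE; last exact: itinerary_borel.
by rewrite mulr_sumr.
Qed.

(** Each cylinder contains at most one point of [s], so its mass is 0 or [1 / size s]. *)
Lemma block_entropy_unif (s : seq X) n : s != [::] -> uniq s ->
  (forall (w : {ffun 'I_n -> 'I_k}) x y, x \in s -> y \in s ->
     itinerary T P w x -> itinerary T P w y -> x = y) ->
  block_entropy (unif s) 0 n = log2 (size s)%:R.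
Proof.
move=> s0 us inj.
have N0 : 0 < (size s)%:R :> R by rewrite ltr0n lt0n size_eq0.
have pw (w : {ffun 'I_n -> 'I_k}) :
    let p := mass (unif s) (itinerary T P w) in p = 0 \/ p = (size s)%:R^-1.
  rewrite /= unif_mass//; last exact: itinerary_borel.
  have [[x xs wx]|nx] := pselect (exists2 x, x \in s & itinerary T P w x).
    right; rewrite (bigD1_seq x)//= big_seq_cond big1 => [|y].
      by rewrite addr0 indicE mem_set// mulr1.
    move=> /andP[ys yx]; rewrite indicE memNset// => wy.
    by move/eqP : yx; apply; exact: (inj w).
  left; rewrite big_seq big1 ?mulr0// => y ys.
  by rewrite indicE memNset// => wy; apply: nx; exists y.
rewrite /block_entropy /shannon -sumrN.
rewrite (eq_bigr (fun w : {ffun 'I_n -> 'I_k} =>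
   mass (unif s) (iter 0 T @^-1` itinerary T P w) * log2 (size s)%:R)).
  by rewrite -mulr_suml block_sum mul1r.
move=> w _; case: (pw w) => /= ->; first by rewrite !mul0r oppr0.
by rewrite /log2 lnV ?posrE// mulNr mulrN opprK.
Qed.

End partition.

Lemma continuity_set_preimage (m : bprob X) (A : set X) n : invariant_measures T m ->
  continuity_set m A -> continuity_set m (iter n T @^-1` A).
Proof.
move=> im [U [C [oU cC UA AC CU0]]].
exists (iter n T @^-1` U), (iter n T @^-1` C); split.
- by apply: open_comp => // x _; exact: iter_continuous.
- by apply: preimage_closed => // x _; exact: iter_continuous.
- by move=> x; exact: UA.
- by move=> x; exact: AC.
have -> : iter n T @^-1` C `\` iter n T @^-1` U = iter n T @^-1` (C `\` U) by [].
rewrite invariant_mass_iter//.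
by apply: measurableD; [exact: closed_borel|exact: open_borel].
Qed.

Lemma continuity_setI (m : bprob X) (A B : set X) :
  continuity_set m A -> continuity_set m B -> continuity_set m (A `&` B).
Proof.
move=> [U [C [oU cC UA AC CU0]]] [V [D [oV cD VB BD DV0]]].
exists (U `&` V), (C `&` D); split.
- exact: openI.
- exact: closedI.
- exact: setISS.
- exact: setISS.
have mC := closed_borel cC; have mD := closed_borel cD.
have mU := open_borel oU; have mV := open_borel oV.
have mCU := measurableD mC mU; have mDV := measurableD mD mV.
apply/eqP; rewrite eq_le mass_ge0 andbT.
rewrite -[leRHS](addr0 0) -{1}CU0 -DV0.
apply: le_trans (massU_le _ mCU mDV); apply: le_mass.
- by apply: measurableD; exact: measurableI.
- exact: measurableU.
- by move=> x [[Cx Dx] /not_andP[nU|nV]]; [left|right].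
Qed.

Lemma continuity_setC (m : bprob X) (A : set X) :
  continuity_set m A -> continuity_set m (~` A).
Proof.
move=> [U [C [oU cC UA AC CU0]]]; exists (~` C), (~` U); split.
- exact: closed_openC.
- exact: open_closedC.
- exact: subsetC.
- exact: subsetC.
- by rewrite setDE setCK setIC -setDE.
Qed.

Lemma continuity_setT (m : bprob X) : continuity_set m setT.
Proof.
exists setT, setT; split; [exact: openT|exact: closedT|by []|by []|].
by rewrite setDv mass0.
Qed.

Lemma continuity_set_itinerary (m : bprob X) k (P : 'I_k -> set X) n
    (w : {ffun 'I_n -> 'I_k}) : invariant_measures T m ->
  (forall i, continuity_set m (P i)) -> continuity_set m (itinerary T P w).
Proof.
move=> im cP.
have -> : itinerary T P w = \big[setI/setT]_(j < n) (iter j T @^-1` P (w j)).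
  rewrite -bigcap_seq/=; apply/seteqP; split => x h j.
    by move=> _; exact: h.
  by apply: h; rewrite /= mem_index_enum.
apply: (big_ind (continuity_set m)); first exact: continuity_setT.
  exact: continuity_setI.
by move=> j _; exact: continuity_set_preimage.
Qed.

End block_entropy.

(** * Bowen entropy *)

Section bowen.
Variables (R : realType) (X : pointedMetricType R) (T : X -> X).
Implicit Types (E F : set X) (t e c : R).
Local Open Scope ereal_scope.

Lemma bowen_sum_ge0 E t n e : 0 <= bowen_sum T E t n e.
Proof.
apply: le_ereal_inf_tmp => _ [D _ <-]; apply: esum_ge0 => p _.
by rewrite lee_fin powR_ge0.
Qed.

Lemma bowen_sum_homo E t e : {homo (fun n => bowen_sum T E t n e) : n m /
  (n <= m)%N >-> n <= m}.
Proof.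
move=> n m nm; apply: ereal_inf_le_tmp => _ [D [cD Dm ED] <-]; exists D => //.
by split => // p /Dm; exact: leq_trans.
Qed.

Lemma bowen_contentE E t e :
  bowen_content T E t e = ereal_sup (range (fun n => bowen_sum T E t n e)).
Proof. by apply/cvg_lim => //; apply: ereal_nondecreasing_cvgn; exact: bowen_sum_homo. Qed.

Lemma bowen_content_ge0 E t e : 0 <= bowen_content T E t e.
Proof.
rewrite bowen_contentE; apply: le_ereal_sup_tmp; exists (bowen_sum T E t 0 e).
  by exists 0%N.
exact: bowen_sum_ge0.
Qed.

Lemma le_bowen_content E F t e : E `<=` F ->
  bowen_content T E t e <= bowen_content T F t e.
Proof.
move=> EF; rewrite !bowen_contentE; apply: ge_ereal_sup => _ [n _ <-].
apply: le_ereal_sup_tmp; exists (bowen_sum T F t n e); first by exists n.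
apply: ereal_inf_le_tmp => _ [D [cD Dm FD] <-]; exists D => //.
by split => //; exact: subset_trans FD.
Qed.

Lemma bowen_content_scale E t e e' : (e <= e')%R ->
  bowen_content T E t e' <= bowen_content T E t e.
Proof.
move=> ee; rewrite !bowen_contentE; apply: ge_ereal_sup => _ [n _ <-].
apply: le_ereal_sup_tmp; exists (bowen_sum T E t n e); first by exists n.
apply: ereal_inf_le_tmp => _ [D [cD Dm ED] <-]; exists D => //.
split => // x /ED[p Dp px]; exists p => // j jp.
exact: le_trans (px j jp) ee.
Qed.

Lemma htop_scale_ge0 E e : 0 <= htop_scale T E e.
Proof. by apply: le_ereal_inf_tmp => _ [t [t0 _] <-]; rewrite lee_fin. Qed.

Lemma le_htop_scale E F e : E `<=` F -> htop_scale T E e <= htop_scale T F e.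
Proof.
move=> EF; apply: ereal_inf_le_tmp => _ [t [t0 F0] <-]; exists t => //.
split => //; apply/eqP; rewrite eq_le bowen_content_ge0 andbT -F0.
exact: le_bowen_content.
Qed.

Lemma htop_scale_homo E e e' : (e <= e')%R -> htop_scale T E e' <= htop_scale T E e.
Proof.
move=> ee; apply: ereal_inf_le_tmp => _ [t [t0 E0] <-]; exists t => //.
split => //; apply/eqP; rewrite eq_le bowen_content_ge0 andbT -E0.
exact: bowen_content_scale.
Qed.

Lemma htopE E : htop T E = ereal_sup [set htop_scale T E e | e in [set e | (0 < e)%R]].
Proof.
have -> : [set e : R | (0 < e)%R] = [set` `]0%R, +oo[].
  by apply/seteqP; split => e /=; rewrite in_itv/= andbT.
apply/cvg_lim => //; apply: nonincreasing_at_right_cvge => //.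
by move=> e e' _ _; exact: htop_scale_homo.
Qed.

Lemma htop_ge0 E : 0 <= htop T E.
Proof.
rewrite htopE; apply: le_ereal_sup_tmp.
exists (htop_scale T E 1); last exact: htop_scale_ge0.
by exists 1%R => //=.
Qed.

Lemma le_htop E F : E `<=` F -> htop T E <= htop T F.
Proof.
move=> EF; rewrite !htopE; apply: ge_ereal_sup => _ [e e0 <-].
apply: le_ereal_sup_tmp; exists (htop_scale T F e); first by exists e.
exact: le_htop_scale.
Qed.

Lemma htop_gt E c : c%:E < htop T E -> exists2 e, (0 < e)%R & c%:E < htop_scale T E e.
Proof. by rewrite htopE => /ereal_sup_gt[_ [e e0 <-] ce]; exists e. Qed.

Lemma bowen_sum_le_size E t n e (s : seq X) : uniq s ->
  (forall y, E y -> exists2 x, x \in s & bowen_ball T n x e y) ->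
  bowen_sum T E t n e <= ((size s)%:R * 2 `^ (- (t * n%:R)))%:E.
Proof.
move=> us sE; apply: ge_ereal_inf.
pose r := [seq (n, x) | x <- s].
exists (\esum_(p in [set` r]) (2 `^ (- (t * p.1%:R)))%:E).
  exists [set` r] => //; split.
  - by apply: finite_set_countable; exact: finite_seq.
  - by move=> p /mapP[x _ ->] /=.
  - move=> y /sE[x xs xy]; exists (n, x) => //=.
    by apply/mapP; exists x.
rewrite esum_fset; [|exact: finite_seq|by move=> p _; rewrite lee_fin powR_ge0].
rewrite -fsbig_seq; last by rewrite map_inj_uniq// => x y [].
rewrite big_map/= sumEFin lee_fin big_const_seq count_predT iter_addr_0.
by rewrite mulr_natl.
Qed.

(** For [t > c], a spanning set of fewer than [2 ^ (c * n)] points gives a cover with [t]-sum at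
    most [2 ^ (- (t - c) * n)]. If this happened for arbitrarily large [n], the content at [t] would
    vanish, against the choice of [t] below [htop_scale]. *)
Lemma spanning_growth E e c : (0 <= c)%R -> c%:E < htop_scale T E e ->
  \forall n \near \oo, forall s : seq X, uniq s ->
    (forall y, E y -> exists2 x, x \in s & bowen_ball T n x e y) ->
    (2 `^ (c * n%:R) <= (size s)%:R)%R.
Proof.
move=> c0 cE.
have [t ct tE] : exists2 t, (c < t)%R & t%:E < htop_scale T E e.
  case: (htop_scale T E e) cE => [h| |]//.
    rewrite lte_fin => ch; exists ((c + h) / 2)%R; first by lra.
    by rewrite lte_fin; lra.
  by move=> _; exists (c + 1)%R; rewrite ?ltry ?ltrDl.
apply: contrapT => nh.
suff : bowen_content T E t e = 0.
  move=> b0; move: tE; rewrite ltNge => /negP; apply.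
  by apply: ereal_inf_lbound; exists t => //; split => //; lra.
rewrite bowen_contentE; apply/eqP; rewrite eq_le; apply/andP; split; last first.
  rewrite -bowen_contentE; exact: bowen_content_ge0.
apply: ge_ereal_sup => _ [N _ <-]; apply/lee_addgt0Pr => d d0; rewrite add0e.
have small : \forall n \near \oo, (2 `^ (- ((t - c) * n%:R)) <= d :> R)%R.
  have a0 : (0 < (t - c) * ln 2)%R by rewrite mulr_gt0 ?ln2_gt0// subr_gt0.
  near=> n; rewrite powRN invf_ple ?posrE ?powR_gt0//.
  rewrite /powR pnatr_eq0/= (le_trans _ (expR_ge1Dx _))//.
  have : ((d^-1 / ((t - c) * ln 2)) <= n%:R :> R)%R by near: n; exact: nbhs_infty_ger.
  rewrite ler_pdivrMr// => h; rewrite (le_trans h)// mulrCA mulrA -mulrA mulrCA mulrA.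
  by rewrite lerDr.
have [n [nN nd [s [us sE sn]]]] : exists n, [/\ (N <= n)%N,
    (2 `^ (- ((t - c) * n%:R)) <= d :> R)%R & exists s : seq X, [/\ uniq s,
    (forall y, E y -> exists2 x, x \in s & bowen_ball T n x e y) &
    ~ (2 `^ (c * n%:R) <= (size s)%:R)%R]].
  apply: contrapT => no; apply: nh; near=> n => s us sE.
  apply: contrapT => sn; apply: no; exists n; split.
  - by near: n; exact: nbhs_infty_ge.
  - by near: n; exact: small.
  - by exists s.
apply: (le_trans (bowen_sum_homo E t e nN)).
apply: (le_trans (bowen_sum_le_size t us sE)).
rewrite lee_fin (le_trans _ nd)//.
move/negP : sn; rewrite -ltNge => /ltW sn.
rewrite (le_trans (ler_wpM2r (powR_ge0 _ _) sn))// -powRD; last first.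
  by rewrite pnatr_eq0 implybT.
by rewrite le_eqVlt; apply/orP; left; apply/eqP; congr powR; ring.
Unshelve. all: by end_near. Qed.

End bowen.

(** * The variational principle *)

Section separated.
Variables (R : realType) (X : pointedMetricType R) (T : X -> X).
Hypotheses (compactX : compact [set: X]) (contT : continuous T).

Lemma mdist_continuous (x : X) : continuous (mdist x : X -> R).
Proof.
move=> y; apply/cvgrPdist_le => e e0.
near=> z.
have yz : mdist y z < e.
  near: z; have := nbhsx_ballx y e e0; rewrite ballEmdist; exact.
have h1 := metric_triangle x y z; have h2 := metric_triangle x z y.
rewrite (metric_sym z y) in h2; rewrite ler_norml; lra.
Unshelve. all: by end_near. Qed.

Lemma closed_mdist_le (x : X) (r : R) : closed [set y | mdist x y <= r].
Proof.
apply: (@preimage_closed _ _ (mdist x) [set s | s <= r]); last exact: closed_le.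
by move=> y _; exact: mdist_continuous.
Qed.

Lemma bowen_nbhs n (x : X) (e : R) : 0 < e ->
  open [set y | forall j, (j < n)%N -> mdist (iter j T x) (iter j T y) < e].
Proof.
move=> e0; rewrite (_ : [set y | _] = \big[setI/setT]_(j < n)
    ((fun y => mdist (iter j T x) (iter j T y)) @^-1` [set r | r < e])).
  apply: (big_ind (@open X)); [exact: openT|exact: openI|move=> j _].
  apply: open_comp; last exact: open_lt.
  move=> y _; apply: continuous_comp; first exact: iter_continuous.
  exact: mdist_continuous.
rewrite -(bigcap_mkord n (fun j =>
  (fun y => mdist (iter j T x) (iter j T y)) @^-1` [set r | r < e])).
by apply/seteqP; split.
Qed.

Definition separated (n : nat) (e : R) (s : seq X) :=
  uniq s /\ {in s &, forall x y, bowen_ball T n x e y -> x = y}.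

(** Finitely many open Bowen balls of radius [e / 2] cover the space, and each contains at most one
    point of a separated list. *)
Lemma separated_size_bound n (e : R) : 0 < e ->
  exists K, forall s, separated n e s -> (size s <= K)%N.
Proof.
move=> e0; have e20 : 0 < e / 2 by exact: divr_gt0.
pose O x := [set y | forall j, (j < n)%N -> mdist (iter j T x) (iter j T y) < e / 2].
have := compactX; rewrite compact_cover => /(_ _ setT O (fun x _ => bowen_nbhs n x e20)) [].
  by move=> x _; exists x => // j _; rewrite mdistxx.
move=> D _ DO; exists (size (finmap.enum_fset D)) => s [us ss].
have /choice[c cP] : forall x, exists y, y \in finmap.enum_fset D /\ O y x.
  by move=> x; have [y yD Oyx] := DO x I; exists y.
rewrite -(size_map c s); apply: uniq_leq_size.
  rewrite map_inj_in_uniq// => x y xs ys cxy; apply: ss => // j jn.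
  have h1 := (cP x).2 j jn; have h2 := (cP y).2 j jn.
  rewrite -cxy in h2; rewrite metric_sym in h1.
  have h3 := metric_triangle (iter j T x) (iter j T (c x)) (iter j T y).
  lra.
by move=> _ /mapP[x _ ->]; exact: (cP x).1.
Qed.

(** A separated list in [L] of maximal length: a point of [L] that it failed to span could be added
    to it. *)
Lemma separated_spanning n (e : R) (L : set X) : 0 < e -> exists s : seq X,
  [/\ separated n e s, forall x, x \in s -> L x &
      forall y, L y -> exists2 x, x \in s & bowen_ball T n x e y].
Proof.
move=> e0; have [K Kb] := separated_size_bound n e0.
pose Q N := `[< exists s : seq X,
  [/\ size s = N, separated n e s & forall x, x \in s -> L x] >].
have Q0 : exists N, Q N by exists 0%N; apply/asboolP; exists [::].
have QK N : Q N -> (N <= K)%N by move/asboolP => [s [<- /Kb]].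
have [N /asboolP[s [sN sep sL]] Nmax] := ex_maxnP Q0 QK.
exists s; split => // y Ly; apply: contrapT => ny.
have ys : y \notin s.
  by apply/negP => ys; apply: ny; exists y => // j _; rewrite mdistxx ltW.
suff /Nmax : Q N.+1 by rewrite ltnn.
apply/asboolP; exists (y :: s); split => /=; first by rewrite sN.
- have [us ss] := sep; split; first by rewrite /= ys.
  move=> x z; rewrite !inE => /predU1P[->|xs] /predU1P[->|zs] // xz.
  + exfalso; apply: ny; exists z => // j jn.
    by rewrite metric_sym; exact: xz.
  + by exfalso; apply: ny; exists x.
  + exact: ss.
- by move=> x; rewrite inE => /predU1P[->//|]; exact: sL.
Qed.

End separated.

(** * Small partitions with null boundaries *)

Section null_boundary.
Variables (R : realType) (X : pointedMetricType R).
Hypothesis compactX : compact [set: X].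

Lemma sphere_borel (x : X) (r : R) : measurable ([set y | mdist x y = r] : set (borel X)).
Proof.
apply: closed_borel.
apply: (@preimage_closed _ _ (mdist x) [set s | s = r]); last exact: closed_eq.
by move=> y _; exact: mdist_continuous.
Qed.

(** Spheres of different radii about [x] are disjoint, so at most [N + 1] of them have mass at least
    [1 / (N + 1)]. *)
Lemma charged_spheres_countable (m : bprob X) (x : X) :
  countable [set r | mass m [set y | mdist x y = r] != 0].
Proof.
have sub : [set r | mass m [set y | mdist x y = r] != 0] `<=`
    \bigcup_N [set r | N.+1%:R^-1 <= mass m [set y | mdist x y = r]].
  move=> r /= mr; have m0 : 0 < mass m [set y | mdist x y = r].
    by rewrite lt_neqAle eq_sym mr mass_ge0.
  exists (Num.truncn (mass m [set y | mdist x y = r])^-1) => //=.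
  by rewrite invf_ple ?posrE// ltW// truncnS_gt.
apply: sub_countable (subset_card_le sub) _.
apply: bigcup_countable => // N _; apply: finite_set_countable.
apply: contrapT => /(infinite_set_fset N.+2)[B BS sB].
have sm : \sum_(r <- finmap.enum_fset B) mass m [set y | mdist x y = r] <= 1.
  rewrite -lee_fin -sumEFin.
  rewrite (eq_bigr (fun r => m [set y | mdist x y = r])); last by move=> i _; rewrite massE.
  rewrite -[leLHS](@measure_fbigsetU _ _ _ m)//.
  - by rewrite [leLHS](massE m _) lee_fin mass_le1.
  - by move=> i _; exact: sphere_borel.
  - by move=> i j _ _ [y [/= <- <-]].
move: sm; apply/negP; rewrite -ltNge.
apply: (@lt_le_trans _ _ (\sum_(r <- finmap.enum_fset B) (N.+1%:R^-1 : R))).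
  rewrite big_const_seq count_predT iter_addr_0 -[ltRHS]mulr_natl.
  by rewrite ltr_pdivlMr ?ltr0n// mul1r ltr_nat.
rewrite !big_seq; apply: ler_sum => r rB.
by apply: BS.
Qed.

Lemma null_sphere (ms : nat -> bprob X) (x : X) (a b : R) : a < b ->
  exists r, a < r < b /\ forall i, mass (ms i) [set y | mdist x y = r] = 0.
Proof.
move=> ab; pose B := \bigcup_i [set r | mass (ms i) [set y | mdist x y = r] != 0].
have cB : countable B.
  by apply: bigcup_countable => // i _; exact: charged_spheres_countable.
have : ~ ([set` `]a, b[] `<=` B).
  move=> abB; have c : countable [set` `]a, b[].
    exact: sub_countable (subset_card_le abB) cB.
  have := countable_lebesgue_measure0 c.
  rewrite lebesgue_measure_itv/= lte_fin ab => /eqP.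
  by rewrite -EFinB eqe subr_eq0 gt_eqF.
move=> /existsNP[r /not_implyP[abr nr]]; exists r; split.
  by move: abr; rewrite /= in_itv.
by move=> i; apply/eqP; apply: contrapT => /negP h; apply: nr; exists i.
Qed.

(** Finitely many balls whose spheres are null for all the [ms n], each deprived of the preceding
    ones. Radii below [e / 2] bound the diameters by [e]; the lower end [e / 4] keeps the radii
    positive. *)
Lemma small_partition (ms : nat -> bprob X) (e : R) : 0 < e ->
  exists k (P : 'I_k -> set X), [/\ finite_partition P,
    forall i x y, P i x -> P i y -> mdist x y <= e &
    forall n i, continuity_set (ms n) (P i)].
Proof.
move=> e0; have e24 : e / 4 < e / 2 by lra.
have /choice[r rP] := fun x => null_sphere ms x e24.
pose U x := [set y | mdist x y < r x].
have oU x : open (U x).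
  apply: (@open_comp _ _ (mdist x) [set s | s < r x]); last exact: open_lt.
  by move=> y _; exact: mdist_continuous.
have cU n x : continuity_set (ms n) (U x).
  exists (U x), [set y | mdist x y <= r x]; split => //.
  - exact: closed_mdist_le.
  - by move=> y; rewrite /U/=; exact: ltW.
  rewrite -[RHS]((rP x).2 n); congr mass; apply/seteqP; split => y /=.
    by move=> [yr /negP]; rewrite -leNgt => ry; apply/eqP; rewrite eq_le yr.
  by move=> h; split; rewrite /U/= h ?ltxx.
have := compactX; rewrite compact_cover => /(_ _ setT U (fun x _ => oU x)) [].
  by move=> x _; exists x => //; rewrite /U/= mdistxx; have [/andP[]] := rP x; lra.
move=> D _ DU; pose s := finmap.enum_fset D; pose B i := U (nth point s i).
exists (size s), (fun i : 'I_(size s) => B i `\` \big[setU/set0]_(j < i) B j).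
split; first split.
- move=> i; apply: measurableD; first by apply: open_borel; exact: oU.
  by apply: bigsetU_measurable => j _; apply: open_borel; exact: oU.
- apply/trivIsetP => i j _ _ ij; rewrite -subset0 => y [[yi nyi] [yj nyj]].
  have /orP[lij|lji] : (i < j)%N || (j < i)%N by rewrite -neq_ltn.
    by apply: nyj; rewrite -bigcup_mkord; exists i.
  by apply: nyi; rewrite -bigcup_mkord; exists j.
- apply/seteqP; split => // y _.
  have ex : exists i, `[< (i < size s)%N /\ B i y >].
    have [x /= xD Uxy] := DU y I; exists (index x s); apply/asboolP.
    by rewrite index_mem; split => //; rewrite /B nth_index.
  have [i /asboolP[si Bi] imin] := ex_minnP ex.
  exists (Ordinal si) => //; split => //; rewrite -bigcup_mkord => -[j /= ji Bj].
  suff : (i <= j)%N by rewrite leqNgt ji.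
  by apply: imin; apply/asboolP; split => //; exact: ltn_trans si.
- move=> i x y [xi _] [yi _]; rewrite /B /U/= in xi yi.
  set z := nth _ _ _ in xi yi; have [/andP[_ rz] _] := rP z.
  have := metric_triangle x z y; rewrite (metric_sym x z); lra.
- move=> n i; rewrite setDE; apply: continuity_setI; first exact: cU.
  apply: continuity_setC; apply: (big_ind (continuity_set (ms n))) => //.
  + by rewrite -setCT; apply: continuity_setC; exact: continuity_setT.
  + move=> A C cA cC; rewrite -[A `|` C]setCK setCU; apply: continuity_setC.
    by apply: continuity_setI; exact: continuity_setC.
  + by move=> j _; exact: cU.
Qed.

End null_boundary.

(** * Orbit averages and Misiurewicz's argument *)

Section orbit_averages.
Variables (R : realType) (X : pointedMetricType R) (T : X -> X).
Hypotheses (compactX : compact [set: X]) (contT : continuous T).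

Definition orbit_unif (s : seq X) (n : nat) : bprob X :=
  unif [seq iter j T x | x <- s, j <- iota 0 n].

Lemma orbit_unif_mass s n (A : set (borel X)) : s != [::] -> (0 < n)%N ->
  measurable A -> mass (orbit_unif s n) A =
    n%:R^-1 * \sum_(j < n) mass (unif s) (iter j T @^-1` A).
Proof.
move=> s0 n0 mA; have sz : size [seq iter j T x | x <- s, j <- iota 0 n] = (size s * n)%N.
  by rewrite size_allpairs size_iota.
rewrite unif_mass//; last first.
  by rewrite -size_eq0 sz muln_eq0 negb_or size_eq0 s0 -lt0n.
rewrite sz natrM invfM [X in X * _]mulrC -mulrA; congr (_ * _).
under [RHS]eq_bigr => j _.
  rewrite unif_mass//; last exact: iter_preimage_borel.
  over.
rewrite -mulr_sumr; congr (_ * _).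
rewrite big_allpairs_dep exchange_big/= -[n in iota 0 n]subn0 -/(index_iota 0 n) big_mkord.
by apply: eq_bigr => j _; apply: eq_bigr => x _; rewrite !indicE.
Qed.

(** The sums for [A] and its preimage telescope to two boundary terms, so the masses differ by at
    most [1 / n i]. *)
Lemma averages_ulim_invariant (F : set_system nat) (nu sigma : nat -> bprob X)
    (n : nat -> nat) : UltraFilter F ->
  (forall N, \forall i \near F, (N <= n i)%N) ->
  (\forall i \near F, forall A : set (borel X), measurable A ->
    mass (nu i) A = (n i)%:R^-1 * \sum_(j < n i) mass (sigma i) (iter j T @^-1` A)) ->
  forall A : set (borel X), measurable A -> ulim F nu (T @^-1` A) = ulim F nu A.
Proof.
move=> UF noo nuE A mA.
have mTA := preimage_borel contT mA.
have d : mass (nu i) (T @^-1` A) - mass (nu i) A @[i --> F] -->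
    ulim F nu (T @^-1` A) - ulim F nu A by apply: cvgB; exact: ulim_cvg.
apply/eqP; rewrite -subr_eq0; apply/eqP.
suff : mass (nu i) (T @^-1` A) - mass (nu i) A @[i --> F] --> (0 : R).
  by move=> c; rewrite -(cvg_lim _ d)// (cvg_lim _ c).
apply/cvgrPdist_le => e e0.
have /= h := noo (Num.truncn e^-1).+1.
apply: filterS2 h nuE => i ni E.
have n0 : (0 < n i)%N by exact: leq_trans ni.
have n0R : 0 < (n i)%:R :> R by rewrite ltr0n.
have ne : (n i)%:R^-1 <= e.
  rewrite invf_ple ?posrE// (le_trans (ltW (truncnS_gt _)))//.
  by rewrite ler_nat.
rewrite !E// -mulrBr.
pose a j := mass (sigma i) (iter j T @^-1` A).
have -> : \sum_(j < n i) mass (sigma i) (iter j T @^-1` (T @^-1` A)) =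
    \sum_(j < n i) a j.+1.
  by apply: eq_bigr => j _; congr mass; apply/funext => x /=.
rewrite -sumrB -(big_mkord xpredT (fun j => a j.+1 - a j)) telescope_sumr//.
have /andP[a0 a1] : 0 <= a (n i) <= 1 by rewrite mass_ge0 mass_le1.
have /andP[b0 b1] : 0 <= a 0%N <= 1 by rewrite mass_ge0 mass_le1.
have i0 : 0 <= (n i)%:R^-1 :> R by rewrite invr_ge0 ltW.
rewrite sub0r normrN normrM ger0_norm//.
have : `|a (n i) - a 0%N| <= 1 by rewrite ler_norml; lra.
by move=> h1; rewrite (le_trans _ ne)// -[leRHS]mulr1 ler_wpM2l.
Qed.

(** The ultrafilter is returned along with the limit because the entropy estimate needs the masses
    of cylinders along it. *)
Lemma orbit_limit (L : set X) (s : nat -> seq X) (n : nat -> nat) :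
  closed L -> T @` L `<=` L -> (forall i x, x \in s i -> L x) ->
  (forall N, \forall i \near \oo, (N <= n i)%N) ->
  (\forall i \near \oo, s i != [::]) ->
  exists F (m : bprob X), [/\ UltraFilter F, \oo `<=` F, invariant_measures T m,
    mass m L = 1 &
    forall C, closed C -> ulim F (fun i => orbit_unif (s i) (n i)) C <= mass m C].
Proof.
move=> cL TL sL noo s0.
have [F [UF ooF]] := ultraFilterLemma (@eventually_filter).
pose nu i := orbit_unif (s i) (n i).
have [m [mC mU _]] := bprob_ultralimit compactX nu UF.
have nuE : \forall i \near F, forall A : set (borel X), measurable A ->
    mass (nu i) A = (n i)%:R^-1 * \sum_(j < n i) mass (unif (s i)) (iter j T @^-1` A).
  have h := ooF _ (noo 1%N); have h' := ooF _ s0.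
  by apply: filterS2 h h' => i ni si A mA; exact: orbit_unif_mass.
have Ln j x : L x -> L (iter j T x).
  by elim: j => [//|j IH] Lx /=; apply: TL; exists (iter j T x) => //; exact: IH.
exists F, m; split => //.
  apply: (ultralimit_invariant compactX contT UF mC mU).
  apply: (@averages_ulim_invariant F nu (fun i => unif (s i)) n) => //.
  by move=> N; apply: ooF; exact: noo.
apply/eqP; rewrite eq_le mass_le1/=; apply: le_trans (mC _ cL).
apply: limr_ge; first exact: ulim_cvg.
have h := ooF _ (noo 1%N); have h' := ooF _ s0.
apply: filterS2 h h' => i ni si; have mL := closed_borel cL.
rewrite /nu /orbit_unif unif_mass//; last first.
  by rewrite -size_eq0 size_allpairs size_iota muln_eq0 negb_or size_eq0 si -lt0n.
rewrite big_seq (eq_bigr (fun=> 1)); last first.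
  by move=> _ /allpairsP[[x j] [/= xs _ ->]]; rewrite indicE mem_set//; apply: Ln; exact: sL xs.
rewrite -big_seq big_const_seq count_predT iter_addr_0 mulVf//.
by rewrite pnatr_eq0 size_allpairs size_iota muln_eq0 negb_or size_eq0 si -lt0n.
Qed.

Lemma krylov_bogolyubov (L : set X) : closed L -> T @` L `<=` L -> L !=set0 ->
  exists2 m : bprob X, invariant_measures T m & mass m L = 1.
Proof.
move=> cL TL [x Lx].
have sL (i : nat) y : y \in [:: x] -> L y by rewrite inE => /eqP ->.
have noo (N : nat) : \forall i \near \oo, (N <= id i)%N by exact: nbhs_infty_ge.
have s0 : \forall i \near \oo, [:: x] != [::] :> seq X by exact: nearW.
have [F [m [_ _ im mL _]]] := orbit_limit cL TL sL noo s0.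
by exists m.
Qed.

Lemma le_shannon_of_limit (W : finType) (F : set_system nat) (p : nat -> W -> R)
    (q : W -> R) (b : R) : ProperFilter F ->
  (forall i w, 0 <= p i w) -> (forall w, 0 <= q w) ->
  (forall w, p i w @[i --> F] --> q w) ->
  (forall d, 0 < d -> \forall i \near F, b <= d + shannon (p i)) -> b <= shannon q.
Proof.
move=> PF p0 q0 pq bp; have l2 := ln2_gt0 R.
apply/ler_addgt0Pr => e e0.
pose N : R := #|W|.+1%:R; have N0 : 0 < N by rewrite ltr0n.
(* Each zero of [q] costs [d / ln 2] in the affine bound, hence at most [e / 2] altogether. *)
pose d := e / 2 * ln 2 / N; have d0 : 0 < d by rewrite !divr_gt0// mulr_gt0// divr_gt0.
pose y w := if q w == 0 then d else q w.
have lim : \sum_w (- (p i w * log2 (y w)) + (y w - p i w) / ln 2) @[i --> F] -->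
    \sum_w (- (q w * log2 (y w)) + (y w - q w) / ln 2).
  apply: cvg_big => [|w _]; first exact: add_continuous.
  apply: cvgD; first by apply: cvgN; apply: cvgMr_tmp.
  by apply: cvgMr_tmp; apply: cvgB => //; exact: cvg_cst.
have step : b - e / 2 <= \sum_w (- (q w * log2 (y w)) + (y w - q w) / ln 2).
  apply: (le_filter_lim _ (cvg_cst _) lim).
  apply: filterS (bp _ (divr_gt0 e0 (ltr0n R 2))) => i.
  rewrite lerBlDl => /le_trans; apply; rewrite lerD2l.
  exact: shannon_le_affine.
suff : \sum_w (- (q w * log2 (y w)) + (y w - q w) / ln 2) <= shannon q + e / 2 by lra.
apply: (@le_trans _ _ (\sum_w (- (q w * log2 (q w)) + d / ln 2))).
  apply: ler_sum => w _; rewrite /y; case: eqVneq => [->|qw].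
    by rewrite !mul0r subr0.
  by rewrite subrr mul0r lerD2l divr_ge0// ltW.
rewrite big_split/= sumrN lerD2l sumr_const -[leLHS]mulr_natl /d.
have -> : #|W|%:R * (e / 2 * ln 2 / N / ln 2) = e / 2 * (#|W|%:R / N).
  by field; rewrite !gt_eqF.
apply: ler_piMr; first by rewrite divr_ge0// ltW.
by rewrite ler_pdivrMr// mul1r ler_nat.
Qed.

(** Misiurewicz's proof: maximal separated sets in [L] have at least [2 ^ (c * n)] points for large
    [n], and the orbit averages of the uniform measures on them accumulate at [m]. The scale [e] is
    that of the separation. *)
Lemma variational_principle (L : set X) (c : R) : closed L -> T @` L `<=` L ->
  0 <= c -> (c%:E < htop T L)%E -> exists e (m : bprob X),
  [/\ 0 < e, invariant_measures T m, mass m L = 1 &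
    forall k (P : 'I_k -> set X), finite_partition P ->
      (forall i x y, P i x -> P i y -> mdist x y <= e) ->
      (forall i, continuity_set m (P i)) ->
      forall q, (0 < q)%N -> q%:R * c <= partition_entropy T m P q].
Proof.
move=> cL TL c0 /htop_gt[e e0 ce].
(* Factorials are eventually divisible by any given [q], so long blocks are cut without
   remainder. *)
pose n i := i.+1`!.
have noo (N : nat) : \forall i \near \oo, (N <= n i)%N.
  near=> i; apply: (@leq_trans i.+1); last by rewrite /n factS leq_pmulr// fact_gt0.
  by apply: leqW; near: i; exact: nbhs_infty_ge.
have /choice[s sP] := fun i => separated_spanning compactX contT (n i) L e0.
have grow : \forall i \near \oo, 2 `^ (c * (n i)%:R) <= (size (s i))%:R.
  have [N _ NP] := spanning_growth c0 ce.
  apply: filterS (noo N) => i Ni.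
  by have [[us _] _ sp] := sP i; exact: (NP (n i)).
have s0 : \forall i \near \oo, s i != [::].
  apply: filterS grow => i; case: (s i) => //=.
  by rewrite leNgt powR_gt0.
have sL i x : x \in s i -> L x by have [_ h _] := sP i; exact: h.
have [F [m [UF ooF im mL mC]]] := orbit_limit cL TL sL noo s0.
exists e, m; split => // k P partP diamP contP q q0.
pose nu i := orbit_unif (s i) (n i).
apply: (@le_shannon_of_limit _ F (fun i (w : {ffun 'I_q -> 'I_k}) =>
  mass (nu i) (itinerary T P w)) (fun w => mass m (itinerary T P w))).
- by move=> i w; exact: mass_ge0.
- by move=> w; exact: mass_ge0.
- move=> w; have mw := itinerary_borel contT partP w.
  rewrite /= -[mass m _](continuity_set_ulim UF mC)//; first exact: ulim_cvg.
  exact: continuity_set_itinerary.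
(* The error of the averaging inequality; it is fixed while [n i] grows, so eventually at most
   [n i * d]. *)
move=> d d0; pose C : R := \sum_(t < q) #|{ffun 'I_t -> 'I_k}|%:R / ln 2.
have C0 : 0 <= C.
  by apply: sumr_ge0 => t _; rewrite divr_ge0// ltW// ln2_gt0.
have h1 := ooF _ grow; have h2 := ooF _ s0.
have h3 := ooF _ (noo (Num.truncn (C / d)).+1).
have h4 : F [set i | (q <= i)%N] by apply: ooF; exact: nbhs_infty_ge.
apply: filterS3 h1 h2 (filterI h3 h4) => i gi si [ni qi].
have n0 : (0 < n i)%N by rewrite fact_gt0.
have n0R : 0 < (n i)%:R :> R by rewrite ltr0n.
have nE : n i = (n i %/ q * q)%N by rewrite divnK// dvdn_fact// q0 (leq_trans qi).
have M0 : (0 < n i %/ q)%N by move: n0; rewrite {1}nE muln_gt0 => /andP[].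
have [[us sep] _ _] := sP i.
have avg : q%:R * block_entropy T P (unif (s i)) 0 (n i) <=
    C + (n i)%:R * block_entropy T P (nu i) 0 q.
  rewrite [in X in block_entropy _ _ _ _ X]nE [in X in _ + X * _]nE.
  apply: block_entropy_averaging => // A mA.
  by rewrite -nE; exact: orbit_unif_mass.
(* Cells have diameter at most [e], so points with the same itinerary share a Bowen ball and
   separated points have different itineraries. *)
rewrite block_entropy_unif// in avg; last first.
  move=> w x y xs ys wx wy; apply: sep => // j jn.
  exact: (diamP (w (Ordinal jn))) (wx (Ordinal jn)) (wy (Ordinal jn)).
have lg : c * (n i)%:R <= log2 (size (s i))%:R.
  have <- : log2 (2 `^ (c * (n i)%:R)) = c * (n i)%:R :> R.
    by rewrite /log2 ln_powR mulfK// gt_eqF// ln2_gt0.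
  by apply: ler_log2 gi; rewrite powR_gt0.
have Cn : C <= (n i)%:R * d.
  rewrite -ler_pdivrMr//; apply: le_trans (ltW (truncnS_gt _)) _.
  by rewrite ler_nat.
rewrite -(ler_pM2l n0R) mulrDr.
have : (n i)%:R * (q%:R * c) <= q%:R * log2 (size (s i))%:R.
  by rewrite mulrCA ler_wpM2l// mulrC.
move=> h; apply: (le_trans h); apply: (le_trans avg); exact: lerD.
Unshelve. all: by end_near. Qed.

End orbit_averages.

(** * Recurrence *)

Section recurrence.
Variables (R : realType) (X : pointedMetricType R) (T : X -> X).
Hypotheses (compactX : compact [set: X]) (contT : continuous T).

Lemma Tran_visits (x : X) (O : set X) : Tran T x -> open O -> O !=set0 ->
  forall N, exists2 n, (N <= n)%N & O (iter n T x).
Proof.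
move=> Tx oO [z Oz] N.
have : omega_limit T x z by rewrite Tx.
move=> /(_ [set y | exists2 n, (N <= n)%N & iter n T x = y] O).
case=> [||y [[n Nn <-] On]]; last by exists n.
- by exists N => // n Nn; exists n.
- exact: open_nbhs_nbhs.
Qed.

Lemma Tran_closed (x : X) (D : set X) : Tran T x -> closed D ->
  (forall y, D y -> D (T y)) -> D x -> D = setT.
Proof.
move=> Tx cD TD Dx; apply/seteqP; split => // z _.
have Dn n : D (iter n T x) by elim: n => [//|n IH]; exact: TD.
apply: contrapT => nDz.
have [n _] := Tran_visits Tx (closed_openC cD) (ex_intro _ z nDz) 0%N.
by apply; exact: Dn.
Qed.

Lemma measure_center_forward (x : X) : limit_measures T x `<=` invariant_measures T ->
  forall y, measure_center T x y -> measure_center T x (T y).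
Proof.
move=> inv y Dy B /contT BT.
have [z [[m Mm mz] Bz]] := Dy _ BT; exists (T z); split => //.
by exists m => //; apply: supp_forward => //; exact: inv.
Qed.

Lemma limsup_frequently (u : nat -> \bar R) : (0 < limn_esup u)%E ->
  exists2 d : R, 0 < d & forall N, exists2 n, (N <= n)%N & (d%:E < u n)%E.
Proof.
move=> u0.
have [d d0 du] : exists2 d : R, 0 < d & (d%:E < limn_esup u)%E.
  case: (limn_esup u) u0 => [r| |]//.
    by rewrite lte_fin => r0; exists (r / 2); rewrite ?lte_fin; lra.
  by move=> _; exists 1 => //; rewrite ltry.
exists d => // N; move: du; rewrite limn_esup_lim => du.
have : (d%:E < esups u N)%E.
  apply: (lt_le_trans du); rewrite (cvg_lim _ (@cvg_esups_inf _ u))//.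
  by apply: ereal_inf_lbound; exists N.
by move=> /ereal_sup_gt[_ [n Nn <-] dn]; exists n.
Qed.

Lemma empirical_mass (x : X) n (A : set (borel X)) : measurable A ->
  mass (empirical T x n.+1) A = n.+1%:R^-1 * \sum_(j < n.+1) \1_A (iter j T x).
Proof. by move=> mA; apply: EFin_inj; rewrite -massE empiricalE. Qed.

(** An ultrafilter concentrated on the times at which the visit frequency exceeds some [d > 0] has a
    limit measure, and the bound survives in the limit because the ball is closed. *)
Lemma QW_closed_ball (x : X) (e : R) :
  (0 < upper_density R (visits T x (ball x e)))%E ->
  exists2 m, limit_measures T x m & 0 < mass m [set y | mdist x y <= e].
Proof.
set C := [set y | _ <= e] => /limsup_frequently[d d0 freq].
have cC : closed C by exact: closed_mdist_le.
have mC := closed_borel cC.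
pose S := [set n | d <= mass (empirical T x n) C].
have Sfreq N : exists2 n, (N <= n)%N & S n.
  have [[|n] Nn dn] := freq N.
    (* At time 0 the quotient is 0 by the convention on inverses, so it cannot exceed [d]. *)
    by move: dn; rewrite invr0 mulr0 lte_fin ltNge ltW.
  exists n.+1 => //; rewrite /S/= empirical_mass// mulrC.
  move: dn; rewrite lte_fin => /ltW/le_trans; apply.
  rewrite ler_wpM2r ?invr_ge0// /count_in add0n big_mkord natr_sum.
  apply: ler_sum => j _; rewrite indicE ler_nat.
  case: asboolP => //= -[_ Bj]; rewrite mem_set//.
  by move: Bj; rewrite ballEmdist /C/=; exact: ltW.
have PS : ProperFilter (within S \oo).
  apply: Build_ProperFilter_ex => B [N _ NB].
  by have [n Nn Sn] := Sfreq N; exists n; exact: NB.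
have [F [UF SF]] := ultraFilterLemma PS.
have [m [mClosed _ em]] := bprob_ultralimit compactX (empirical T x) UF.
exists m.
  move=> A B eA Bm; have FA : F (empirical T x @^-1` A).
    by apply: SF; apply: (@filterS _ \oo _ _ _ _ eA) => n An _.
  have FB : F (empirical T x @^-1` B) := em B Bm.
  have [n [An Bn]] := filter_ex (filterI FA FB).
  by exists (empirical T x n).
apply: (lt_le_trans d0); apply: le_trans (mClosed _ cC).
apply: limr_ge; first exact: ulim_cvg.
by apply: SF; exact: withinT.
Qed.

(** Every small closed ball about [x] is charged by a limit measure, so [x] lies in its own measure
    center; that center is closed and forward invariant, hence contains the closure of the orbit. *)
Lemma QW_measure_center (x : X) : Tran T x ->
  limit_measures T x `<=` invariant_measures T -> QW T x ->
  measure_center T x = setT.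
Proof.
move=> Tx inv qx; apply: (Tran_closed Tx).
- exact: closed_closure.
- exact: measure_center_forward.
move=> B /nbhs_ballP[e /= e0 eB].
have e20 : 0 < e / 2 by exact: divr_gt0.
have [m Mm mC] := QW_closed_ball (qx _ e20).
have cC : closed [set y | mdist x y <= e / 2] by exact: closed_mdist_le.
have [y [xy my]] := supp_meets_closed compactX cC mC.
exists y; split; first by exists m.
apply: eB; rewrite ballEmdist/=; move: xy => /=; lra.
Qed.

(* Integrating the number of visits shows that some orbit segment of length [l]
   spends in [U] at least the fraction [mass m U] of its time. *)
Lemma frequent_segment (m : bprob X) (U : set X) l : invariant_measures T m ->
  open U -> exists z, l%:R * mass m U <=
    (\sum_(j < l) (`[< U (iter j T z) >] : nat))%N%:R.
Proof.
move=> im oU; pose cnt z := (\sum_(j < l) (`[< U (iter j T z) >] : nat))%N.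
have cl z : (cnt z <= l)%N.
  rewrite -[leqRHS]card_ord -sum1_card; apply: leq_sum => j _.
  by case: `[< _ >].
pose Q M := `[< exists z, cnt z = M >].
have Q0 : exists M, Q M by exists (cnt point); apply/asboolP; exists point.
have Ql M : Q M -> (M <= l)%N by move/asboolP => [z <-].
have [M /asboolP[z zM] Mmax] := ex_maxnP Q0 Ql.
exists z; rewrite -/(cnt z) zM.
have iA (j : 'I_l) : m.-integrable setT (EFin \o (\1_(iter j T @^-1` U) : X -> R)).
  by apply: indic_integrable; apply: iter_preimage_borel => //; exact: open_borel.
have [i1 i2] := Rintegral_sum (index_enum 'I_l) iA.
have E : \sum_(j < l) \int[m]_x \1_(iter j T @^-1` U) x = l%:R * mass m U.
  rewrite (eq_bigr (fun=> mass m U)).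
    by rewrite sumr_const card_ord mulr_natl.
  move=> j _; have mj : measurable (iter j T @^-1` U : set (borel X)).
    by apply: iter_preimage_borel => //; exact: open_borel.
  rewrite /Rintegral integral_indic// setIT -/(mass m _) invariant_mass_iter//.
  exact: open_borel.
have cM : m.-integrable setT (EFin \o (fun=> M%:R) : X -> \bar R).
  by apply: (@bounded_integrable _ _ m _ `|M%:R|).
have cE : \int[m]_x (M%:R : R) = M%:R.
  by rewrite Rintegral_cst// -/(mass m setT) massT mulr1.
rewrite -E -i2 -cE.
apply: le_Rintegral => // y _.
have : (cnt y <= M)%N by apply: Mmax; apply/asboolP; exists y.
rewrite -(ler_nat R); apply: le_trans; rewrite /cnt natr_sum.
apply: ler_sum => j _; rewrite indicE ler_nat.
by case: asboolP => [_|nU]; [exact: leq_b1|rewrite memNset].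
Qed.

(** Some orbit segment spends a fraction at least [mass m U > 0] of its time in the ball [U].
    Following it into [U] at these times is an open condition, met by the transitive orbit at some
    time [a], which gives a window as long as desired. *)
Lemma Tran_BR (x : X) (m : bprob X) : Tran T x -> invariant_measures T m ->
  supp m = setT -> BR T x.
Proof.
move=> Tx im sm e e0; set U := ball x e.
have UE : U = [set y | mdist x y < e] by rewrite /U ballEmdist.
have oU : open U.
  rewrite UE; apply: (@open_comp _ _ (mdist x) [set r | r < e]); last exact: open_lt.
  by move=> y _; exact: mdist_continuous.
have U0 : 0 < mass m U.
  have : supp m x by rewrite sm.
  by move/supp_mass; apply => //; exact: ballxx.
apply: (@lt_le_trans _ _ (mass m U)%:E); first by rewrite lte_fin.
apply: le_ereal_inf_tmp => _ [N _ <-].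
(* The length [N.+1] is at least [N] and never zero. *)
have [z zU] := frequent_segment N.+1 im oU.
pose O := [set y | forall j, (j < N.+1)%N -> U (iter j T z) -> U (iter j T y)].
have oO : open O.
  rewrite (_ : O = \big[setI/setT]_(j < N.+1)
      [set y | U (iter j T z) -> U (iter j T y)]).
    apply: (big_ind (@open X)); [exact: openT|exact: openI|move=> j _].
    have [Uz|nUz] := pselect (U (iter j T z)).
      rewrite (_ : mkset _ = iter j T @^-1` U).
        by apply: open_comp => // y _; exact: iter_continuous.
      by apply/seteqP; split => y /=; [apply|].
    rewrite (_ : mkset _ = setT); first exact: openT.
    by apply/seteqP; split => // y _ /nUz.
  rewrite -(bigcap_mkord N.+1 (fun j => [set y | U (iter j T z) -> U (iter j T y)])).
  by apply/seteqP; split.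
(* The window starts at a time at least 1 because [visits] counts positive times only. *)
have [a a1 Oa] := Tran_visits Tx oO (ex_intro _ z (fun j _ => id)) 1.
apply: le_ereal_sup_tmp.
exists ((count_in (visits T x U) a N.+1)%:R / N.+1%:R)%:E.
  by exists (a, N.+1) => //=.
rewrite lee_fin ler_pdivlMr ?ltr0n// mulrC (le_trans zU)// ler_nat.
rewrite /count_in -{1}[a]add0n big_addn addKn big_mkord.
apply: leq_sum => j _; case: asboolP => // Uz.
case: asboolP => // h; exfalso; apply: h; split; first by rewrite addn_gt0 a1 orbT.
by rewrite iterD; exact: Oa.
Qed.

Lemma Tran_BRsharp (x : X) (m : bprob X) : Tran T x -> invariant_measures T m ->
  supp m = setT -> limit_measures T x `<=` invariant_measures T ->
  measure_center T x <> setT -> BRsharp T x.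
Proof.
move=> Tx im sm inv nc; split; first exact: Tran_BR sm.
by move=> /(QW_measure_center Tx inv).
Qed.

End recurrence.

Lemma midpoint_between (R : realType) (x y : R) : x != y ->
  [/\ Num.min x y <= (x + y) / 2 <= Num.max x y, x != (x + y) / 2 & y != (x + y) / 2].
Proof.
rewrite neq_lt => /orP[h|h].
  have h1 : x < (x + y) / 2 by lra.
  have h2 : (x + y) / 2 < y by lra.
  by rewrite min_l ?max_r ?ltW// (lt_eqF h1) (gt_eqF h2).
have h1 : y < (x + y) / 2 by lra.
have h2 : (x + y) / 2 < x by lra.
by rewrite min_r ?max_l ?ltW// (lt_eqF h1) (gt_eqF h2).
Qed.

(** * Values of [alpha] along segments and irregular points *)

Section observable.
Variables (R : realType) (X : pointedMetricType R) (T : X -> X).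
Variable alpha : bprob X -> R.
Hypotheses (compactX : compact [set: X]) (contT : continuous T).
Hypothesis cont_alpha : {within invariant_measures T, continuous alpha}.
Hypothesis A3 : conditionA3 T alpha.
Implicit Types (m n : bprob X).

Lemma alpha_separates m : interior (alpha_range T alpha) !=set0 ->
  invariant_measures T m -> exists2 n, invariant_measures T n & alpha n <> alpha m.
Proof.
have absurd (s e a : R) : a <= s <= a -> a <= s + e / 2 <= a -> 0 < e -> False by lra.
move=> [r ir] im; apply: contrapT => h.
have aE : alpha @` invariant_measures T = [set alpha m].
  apply/seteqP; split => [_ [n in_ <-]|_ ->]; last by exists m.
  by apply: contrapT => nm; apply: h; exists n.
move: ir; rewrite /alpha_range aE inf1 sup1 => /nbhs_ballP[e /= e0 re].
have h1 : alpha m <= r <= alpha m.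
  by have /= := re r (ballxx r e0); rewrite in_itv.
have h2 : alpha m <= r + e / 2 <= alpha m.
  have /= := re (r + e / 2); rewrite in_itv; apply.
  rewrite /ball/= opprD addrA subrr sub0r normrN ger0_norm; lra.
exact: absurd h1 h2 e0.
Qed.

(** [alpha] is continuous only relative to the invariant measures, and the segment stays among
    them. *)
Lemma alpha_segment_continuous m n : invariant_measures T m ->
  invariant_measures T n -> continuous (alpha \o segment m n).
Proof.
move=> im in_ r V aV.
have is_ s : invariant_measures T (segment m n s) by exact: segment_invariant.
have /subspace_continuousP/(_ _ (is_ r) V aV) h := cont_alpha.
have h' : nbhs (segment m n r) [set y | invariant_measures T y -> V (alpha y)] := h.
have g : nbhs r (segment m n @^-1` [set y | invariant_measures T y -> V (alpha y)]) :=
  @segment_continuous _ _ m n compactX r _ h'.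
by apply: (@filterS _ _ _ _ _ _ g) => s; apply; exact: is_.
Qed.

Lemma A3_segment m n (a b : R) : invariant_measures T m -> invariant_measures T n ->
  alpha m <> alpha n -> 0 <= a -> a < b -> b <= 1 ->
  exists r s, [/\ a <= r <= b, a <= s <= b &
    alpha (segment m n r) <> alpha (segment m n s)].
Proof.
move=> im in_ mn a0 ab b1; apply: contrapT => h.
have a1 : a <= 1 by lra.
have b0 : 0 <= b by lra.
apply: (A3 im in_ mn (a := Itv01 a0 a1) (b := Itv01 b0 b1) ab).
exists (alpha (segment m n a)) => t tab; rewrite -segment_mix.
apply: contrapT => nt; apply: h; exists t%:num, a; split => //.
by rewrite lexx ltW.
Qed.

(** [A.3] gives two different values on [[a, 1]]; the intermediate value theorem adds their mean. *)
Lemma three_values m n (a : R) : invariant_measures T m -> invariant_measures T n ->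
  alpha m <> alpha n -> 0 <= a < 1 -> exists r : 'I_3 -> R,
    (forall i, a <= r i <= 1) /\ injective (fun i => alpha (segment m n (r i))).
Proof.
move=> im in_ mn /andP[a0 a1].
have [r [s [ra sa rs]]] := A3_segment im in_ mn a0 a1 (lexx 1).
wlog lrs : r s ra sa rs / r <= s.
  move=> H; have [|/ltW] := leP r s; first exact: H.
  by apply: H => // /esym.
pose f := alpha \o segment m n.
have cf : {within `[r, s], continuous f}.
  by apply: continuous_subspaceT; exact: alpha_segment_continuous.
have {}rs : f r != f s by exact/eqP.
have [mid rm sm] := midpoint_between rs.
have [t trs ft] := IVT lrs cf mid.
have frt : f r != f t by rewrite ft.
have fst : f s != f t by rewrite ft.
move: ra sa => /andP[ar r1] /andP[as_ s1].
exists (nth 0 [:: r; s; t]); split.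
  move: trs; rewrite in_itv/= => /andP[rt ts].
  case=> [[|[|[|//]]]] Hi /=; rewrite ?ar ?r1 ?as_ ?s1//.
  by rewrite (le_trans ar rt) (le_trans ts s1).
move=> i j fij; apply: val_inj; apply/eqP.
rewrite -(nth_uniq 0 (s := map f [:: r; s; t])) ?ltn_ord//.
  by rewrite !(nth_map 0) ?ltn_ord//; apply/eqP.
by rewrite /= !inE negb_or rs frt fst.
Qed.

(** Compactness bounds [alpha] on the limit measures, so that [inf] and [sup] there are genuine
    bounds and not default values. *)
Lemma irregular_of_two x m n : compact (limit_measures T x) ->
  limit_measures T x `<=` invariant_measures T ->
  limit_measures T x m -> limit_measures T x n -> alpha m <> alpha n ->
  irregular_set T alpha x.
Proof.
move=> cK Kinv Km Kn mn.
wlog lmn : m n Km Kn mn / alpha m < alpha n.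
  move=> H; have [h|h|//] := ltgtP (alpha m) (alpha n); first exact: (H m n).
  by apply: (H n m) => // /esym.
have ca : {within limit_measures T x, continuous alpha}.
  exact: continuous_subspaceW Kinv cont_alpha.
have /compact_bounded[M [_ /(_ (M + 1))]] := continuous_compact ca cK.
rewrite ltrDl => /(_ ltr01) MB.
have bnd y : (alpha @` limit_measures T x) y -> - (M + 1) <= y <= M + 1.
  by move=> Ay; rewrite -ler_norml; exact: MB.
rewrite /irregular_set/=; apply: (@le_lt_trans _ _ (alpha m)).
  apply: ge_inf; last by exists m.
  by exists (- (M + 1)) => y /bnd /andP[].
apply: (lt_le_trans lmn); apply: ub_le_sup; last by exists n.
by exists (M + 1) => y /bnd /andP[].
Qed.

End observable.

(** * Three measures of large entropy *)

Section assembly.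
Variables (R : realType) (X : pointedMetricType R) (T : X -> X).
Variable alpha : bprob X -> R.
Hypotheses (compactX : compact [set: X]) (contT : continuous T).
Hypothesis denseT : entropy_dense T.
Hypothesis cont_alpha : {within invariant_measures T, continuous alpha}.
Hypothesis A3 : conditionA3 T alpha.
Hypothesis int_alpha : interior (alpha_range T alpha) !=set0.

(** Entropy density with [eta = c' - c], on the neighborhood where [alpha] moves by less than [d],
    followed by the variational principle on the resulting set. *)
Lemma dense_measure m (c c' d : R) : invariant_measures T m -> 0 <= c -> c < c' ->
  (c'%:E <= metric_entropy T m)%E -> 0 < d ->
  exists (L : set X) (e : R) (m' : bprob X),
  [/\ closed L, T @` L `<=` L,
      forall n, invariant_measures T n -> supp n `<=` L -> `|alpha n - alpha m| < d,
      invariant_measures T m' & mass m' L = 1] /\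
  (0 < e /\ forall k (P : 'I_k -> set X), finite_partition P ->
      (forall i x y, P i x -> P i y -> mdist x y <= e) ->
      (forall i, continuity_set m' (P i)) ->
      forall q, (0 < q)%N -> q%:R * c <= partition_entropy T m' P q).
Proof.
move=> im c0 cc' c'm d0.
have /subspace_continuousP/(_ _ im) h := cont_alpha.
have /= G := h _ (nbhsx_ballx (alpha m) d d0).
have cc0 : 0 < c' - c by rewrite subr_gt0.
have [L [cL TL LG hL]] := denseT im G cc0.
have cL' : (c%:E < htop T L)%E.
  apply: le_lt_trans hL; rewrite leeBrDr// -EFinD.
  by rewrite addrC subrK.
have [e [m' [e0 im' m'L Pm']]] := variational_principle compactX contT cL TL c0 cL'.
exists L, e, m'; do 2 split => //.
move=> n in_ nL; have /= := LG n in_ nL in_.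
by rewrite /ball/= distrC.
Qed.

Lemma three_measures (c : R) : 0 <= c -> (c%:E < htop T setT)%E ->
  exists (L : 'I_3 -> set X) (mu : 'I_3 -> bprob X) k (P : 'I_k -> set X),
  [/\ forall i, closed (L i) /\ T @` L i `<=` L i,
      forall i j, i != j -> L i `&` L j = set0,
      forall i, invariant_measures T (mu i) /\ mass (mu i) (L i) = 1,
      injective (alpha \o mu) &
      finite_partition P /\
      forall i q, (0 < q)%N -> q%:R * c <= partition_entropy T (mu i) P q].
Proof.
move=> c0 cX.
(* Room for two losses of entropy: from [c1] to [c2] along the segment, from [c2] to [c] by entropy
   density. *)
have [c1 [cc1 c1X]] : exists c1, c < c1 /\ (c1%:E < htop T setT)%E.
  case: (htop T setT) cX => [h| |]//.
    by rewrite lte_fin => ch; exists ((c + h) / 2); rewrite lte_fin; lra.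
  by move=> _; exists (c + 1); rewrite ltry ltrDl.
have c10 : 0 < c1 by lra.
have [e [m0 [e0 im0 _ Pm0]]] := variational_principle compactX contT closedT
  (@subsetT _ _) (ltW c10) c1X.
have [k [P [partP diamP contP]]] := small_partition compactX (fun=> m0) e0.
have entm0 := Pm0 k P partP diamP (contP 0%N).
have [n in_ nm] := alpha_separates int_alpha im0.
(* With weight [r >= c2 / c1] on [m0], concavity leaves at least [r * c1 >= c2], since the other
   measure contributes a nonnegative amount. *)
pose c2 := (c + c1) / 2; pose a := c2 / c1.
have c21 : c < c2 < c1 by rewrite /c2; lra.
have a01 : 0 <= a < 1.
  by rewrite /a divr_ge0 ?ltW//=; [rewrite ltr_pdivrMr// mul1r; lra|lra].
have [r [ra rinj]] := three_values compactX contT cont_alpha A3 im0 in_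
  (nesym nm) a01.
pose m i := segment m0 n (r i).
have im i : invariant_measures T (m i) by exact: segment_invariant.
have r01 i : 0 <= r i <= 1.
  by have /andP[ari ->] := ra i; have /andP[a0 _] := a01; rewrite (le_trans a0).
have c2m i : (c2%:E <= metric_entropy T (m i))%E.
  apply: (metric_entropy_ge contT partP) => // q q0.
  apply: le_trans (partition_entropy_segment contT partP m0 n q (r01 i)).
  have /andP[ri0 ri1] := r01 i; have /andP[ari _] := ra i.
  have h1 : q%:R * c2 <= r i * (q%:R * c1).
    by rewrite [leRHS]mulrCA ler_wpM2l// -ler_pdivrMr.
  have h2 : r i * (q%:R * c1) <= r i * partition_entropy T m0 P q.
    by rewrite ler_wpM2l// entm0.
  have h3 : 0 <= (1 - r i) * partition_entropy T n P q.
    rewrite mulr_ge0// ?subr_ge0// partition_entropyE; exact: block_entropy_ge0.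
  lra.
pose gap (p : 'I_3 * 'I_3) := `|alpha (m p.1) - alpha (m p.2)|.
(* Half the least gap: no number is within less than [d] of two of the values. The seed 1 of the
   minimum is harmless. *)
pose d : R := (\big[Order.min/1]_(p : 'I_3 * 'I_3 | p.1 != p.2) gap p) / 2.
have d0 : 0 < d.
  rewrite divr_gt0//; apply: lt_bigmin => // -[i j] /= ij.
  by rewrite normr_gt0 subr_eq0; apply: contraNN ij => /eqP/rinj /= ->.
have dP i j : i != j -> 2 * d <= `|alpha (m i) - alpha (m j)|.
  move=> ij; rewrite /d mulrC divfK//.
  exact: (@bigmin_le_cond _ _ _ _ (i, j) (fun p : 'I_3 * 'I_3 => p.1 != p.2) gap ij).
have /andP[cc2 _] := c21.
have /choice[L /choice[e' /choice[mu LP]]] :=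
  fun i => dense_measure (im i) c0 cc2 (c2m i) d0.
(* A nonempty intersection is closed and forward invariant, so by Krylov-Bogolyubov it carries an
   invariant measure, whose [alpha]-value would be within less than [d] of two of the values. *)
have disj i j : i != j -> L i `&` L j = set0.
  move=> ij; apply: contrapT => /eqP/set0P LL.
  have [[cLi TLi ai _ _] _] := LP i; have [[cLj TLj aj _ _] _] := LP j.
  have TLL : T @` (L i `&` L j) `<=` L i `&` L j.
    by move=> _ [x [xi xj] <-]; split; [apply: TLi|apply: TLj]; exists x.
  have [n' in' n'L] := krylov_bogolyubov compactX contT (closedI cLi cLj) TLL LL.
  have sL := supp_sub_closed (closedI cLi cLj) n'L.
  have h1 := ai _ in' (subset_trans sL (@subIsetl _ _ _)).
  have h2 := aj _ in' (subset_trans sL (@subIsetr _ _ _)).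
  have h3 := dP i j ij.
  have h4 := ler_distD (alpha n') (alpha (m i)) (alpha (m j)).
  rewrite (distrC (alpha (m i)) (alpha n')) in h4; lra.
have e'0 : 0 < \big[Order.min/1]_(i : 'I_3) e' i.
  by apply: lt_bigmin => // i _; have [_ []] := LP i.
(* The common partition: finer than the least of the three scales, with boundaries null for all
   three measures. *)
have [k' [Q [partQ diamQ contQ]]] := small_partition compactX (fun j => mu (inord j)) e'0.
exists L, mu, k', Q; split => //.
- by move=> i; have [[]] := LP i.
- by move=> i; have [[]] := LP i.
- move=> i j /= aij; apply/eqP; apply: contrapT => /negP ij.
  have [[cLi _ ai imi mi] _] := LP i; have [[cLj _ aj imj mj] _] := LP j.
  have h1 := ai _ imi (supp_sub_closed cLi mi).
  have h2 := aj _ imj (supp_sub_closed cLj mj).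
  have h3 := dP i j ij.
  have h4 := ler_distD (alpha (mu i)) (alpha (m i)) (alpha (m j)).
  rewrite (distrC (alpha (m i)) (alpha (mu i))) aij in h4.
  by rewrite aij in h1; lra.
split => // i q q0; have [_ [_ h]] := LP i; apply: h => //.
- move=> l x y xl yl; apply: (le_trans (diamQ l x y xl yl)).
  exact: bigmin_le.
- by move=> l; have := contQ i l; rewrite inord_val.
Qed.

End assembly.

(** * The gaps *)

Section gaps.
Variables (R : realType) (X : pointedMetricType R) (T : X -> X).
Variable alpha : bprob X -> R.
Hypotheses (compactX : compact [set: X]) (contT : continuous T).
Hypothesis satT : transitively_convex_saturated T.
Hypothesis cont_alpha : {within invariant_measures T, continuous alpha}.
Hypothesis A3 : conditionA3 T alpha.
Hypothesis full : exists2 m : bprob X, invariant_measures T m & supp m = [set: X].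

Lemma segment_convex_hull n (nu : 'I_n -> bprob X) i j (r : R) : 0 <= r <= 1 ->
  convex_hull nu (segment (nu i) (nu j) r).
Proof.
move=> r01; have /andP[r0 r1] := r01.
(* Writing the weights as a sum also covers the case [i = j]. *)
exists (fun l => r * (l == i)%:R + (1 - r) * (l == j)%:R); split.
- by move=> l; rewrite addr_ge0// mulr_ge0// subr_ge0.
- rewrite big_split/= -!mulr_sumr.
  have one (l0 : 'I_n) : \sum_(l < n) (l == l0)%:R = 1 :> R.
    by rewrite (bigD1 l0)//= eqxx big1 ?addr0// => l /negbTE ->.
  by rewrite !one !mulr1 addrC subrK.
move=> A mA; rewrite massE segment_mass//.
under eq_bigr do rewrite massE -EFinM.
rewrite sumEFin; congr EFin.
under eq_bigr do rewrite mulrDl.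
rewrite big_split/=; congr (_ + _).
  by rewrite (bigD1 i)//= eqxx mulr1 big1 ?addr0// => l /negbTE ->; rewrite mulr0 mul0r.
by rewrite (bigD1 j)//= eqxx mulr1 big1 ?addr0// => l /negbTE ->; rewrite mulr0 mul0r.
Qed.

Variables (c : R) (L : 'I_3 -> set X) (mu : 'I_3 -> bprob X).
Variables (k : nat) (P : 'I_k -> set X).
Hypothesis invL : forall i, closed (L i) /\ T @` L i `<=` L i.
Hypothesis disjL : forall i j, i != j -> L i `&` L j = set0.
Hypothesis muL : forall i, invariant_measures T (mu i) /\ mass (mu i) (L i) = 1.
Hypothesis alpha_inj : injective (alpha \o mu).
Hypothesis partP : finite_partition P.
Hypothesis entropyP : forall i q, (0 < q)%N -> q%:R * c <= partition_entropy T (mu i) P q.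

Let S i := supp (mu i).

Let SL i : S i `<=` L i.
Proof. by have [_ m1] := muL i; apply: supp_sub_closed => //; have [] := invL i. Qed.

Let S0 i : S i !=set0. Proof. exact: supp_nonempty. Qed.

Let Sdisj i j x : i != j -> S i x -> ~ S j x.
Proof. by move=> ij /SL xi /SL xj; have : set0 x by rewrite -(disjL ij). Qed.

(** If [D] were the whole space, the transitive point would lie in some [L i], which would then be
    everything, although another [L j] is nonempty and disjoint from it. *)
Lemma proper_union (D : set X) x : Tran T x -> D `<=` \bigcup_i L i -> D <> setT.
Proof.
move=> Tx DL D1; have [i _ Lix] : (\bigcup_i L i) x by apply: DL; rewrite D1.
have [cLi TLi] := invL i.
have LT : L i = setT.
  by apply: (Tran_closed Tx cLi) => // y Ly; apply: TLi; exists y.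
have [j ij] : exists j : 'I_3, i != j.
  by exists (if i == ord0 then ord_max else ord0); case: (eqVneq i ord0) => [->|].
have [y Sy] := S0 j; have : (L i `&` L j) y by split; [rewrite LT|exact: SL].
by rewrite disjL.
Qed.

Definition on_segments (K : set (bprob X)) := forall m, K m ->
  exists i j r, 0 <= r <= 1 /\ m = segment (mu i) (mu j) r.

Lemma on_segments_invariant K : on_segments K -> K `<=` invariant_measures T.
Proof.
move=> KS m /KS[i [j [r [_ ->]]]].
by apply: segment_invariant => //; [have [] := muL i|have [] := muL j].
Qed.

Lemma supp_on_segments K m : on_segments K -> K m -> supp m `<=` \bigcup_i L i.
Proof.
move=> KS /KS[i [j [r [/andP[r0 r1] ->]]]] x.
have [->|rn0] := eqVneq r 0; first by rewrite segment0 => /SL; exists j.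
have [->|rn1] := eqVneq r 1; first by rewrite segment1 => /SL; exists i.
rewrite supp_segment; first by case=> /SL; [exists i|exists j].
by rewrite !lt_neqAle eq_sym rn0 r0 rn1.
Qed.

Lemma saturated_entropy K : K !=set0 -> compact K -> connected K ->
  on_segments K -> (c%:E <= htop T (saturated_set T K))%E.
Proof.
move=> K0 cK conK KS.
have [|_ ->] := satT K0 cK conK (on_segments_invariant KS).
  exists 3, mu; split; first by move=> i; have [] := muL i.
  by move=> m /KS[i [j [r [r01 ->]]]]; exact: segment_convex_hull.
apply: le_ereal_inf_tmp => _ [m Km <-].
apply: (metric_entropy_ge contT partP); first exact: on_segments_invariant Km.
move=> q q0; have [i [j [r [r01 ->]]]] := KS m Km.
apply: le_trans (partition_entropy_segment contT partP _ _ q r01).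
have hi := entropyP i q0; have hj := entropyP j q0; have /andP[r0 r1] := r01.
nra.
Qed.

(** The part common to the five gaps. What remains for each is to choose [K] and to read off
    membership in [E] from the supports of the measures in [K]. *)
Lemma gap_of_measures K m n (E : set X) : K !=set0 -> compact K -> connected K ->
  on_segments K -> K m -> K n -> alpha m <> alpha n ->
  (forall x, limit_measures T x = K -> BRsharp T x -> E x) ->
  (c%:E <= htop T (E `&` (irregular_set T alpha `&` Tran T)))%E.
Proof.
move=> K0 cK conK KS Km Kn mn KE.
apply: (le_trans (saturated_entropy K0 cK conK KS)); apply: le_htop => x [Tx xK].
have Kinv := on_segments_invariant KS.
have [m0 im0 sm0] := full.
split; last split => //.
  apply: KE => //; apply: (Tran_BRsharp compactX contT Tx im0 sm0).
    by rewrite xK.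
  apply: (proper_union Tx); rewrite /measure_center xK.
  have cU : closed (\bigcup_i L i).
    by apply: closed_bigcup => [|i _]; [exact: finite_finset|have [] := invL i].
  rewrite closureE; apply: smallest_sub => //.
  by move=> z [n' Kn']; exact: (supp_on_segments KS Kn').
by apply: (irregular_of_two cont_alpha _ _ _ _ mn); rewrite xK.
Qed.

(** The parameter is the weight of [mu ord0]: the value 1 gives [mu ord0] and 0 gives [mu j]. *)
Definition arc j (a b : R) : set (bprob X) := segment (mu ord0) (mu j) @` `[a, b].

Lemma arc_on_segments j a b : 0 <= a -> b <= 1 -> on_segments (arc j a b).
Proof.
move=> a0 b1 _ [r + <-]; rewrite /= in_itv/= => /andP[ar rb].
by exists ord0, j, r; rewrite (le_trans a0) ?(le_trans rb).
Qed.

Lemma arc_mem j a b r : a <= r <= b -> arc j a b (segment (mu ord0) (mu j) r).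
Proof. by move=> arb; exists r => //=; rewrite in_itv. Qed.

Lemma arc_supp_sub j a b m : 0 <= a -> b <= 1 -> arc j a b m ->
  supp m `<=` S ord0 `|` S j.
Proof.
move=> a0 b1 [r + <-]; rewrite /= in_itv/= => /andP[ar rb] x.
have [->|rn0] := eqVneq r 0; first by rewrite segment0; right.
have [->|rn1] := eqVneq r 1; first by rewrite segment1; left.
by rewrite supp_segment// !lt_neqAle eq_sym rn0 rn1 (le_trans a0) ?(le_trans rb).
Qed.

Lemma arc_supp0 j a b m : 0 < a -> b <= 1 -> arc j a b m -> S ord0 `<=` supp m.
Proof.
move=> a0 b1 [r + <-]; rewrite /= in_itv/= => /andP[ar rb] x.
have [->|rn1] := eqVneq r 1; first by rewrite segment1.
rewrite supp_segment; first by left.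
by rewrite (lt_le_trans a0)//= lt_neqAle rn1 (le_trans rb).
Qed.

Lemma arc_midpoint j a b : 0 <= a -> a < b -> b <= 1 ->
  exists2 m, arc j a b m & supp m = S ord0 `|` S j.
Proof.
move=> a0 ab b1; exists (segment (mu ord0) (mu j) ((a + b) / 2)).
  by apply: arc_mem; lra.
by rewrite supp_segment//; lra.
Qed.

Lemma arc_two_values j a b : ord0 != j -> 0 <= a -> a < b -> b <= 1 ->
  exists m n, [/\ arc j a b m, arc j a b n & alpha m <> alpha n].
Proof.
move=> j0 a0 ab b1; have [i0 _] := muL ord0; have [ij _] := muL j.
have nj : alpha (mu ord0) <> alpha (mu j).
  by move=> e; move/eqP : j0; apply; exact: alpha_inj.
have [r [s [ra sa rs]]] := A3_segment A3 i0 ij nj a0 ab b1.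
by exists (segment (mu ord0) (mu j) r), (segment (mu ord0) (mu j) s); split => //;
  exact: arc_mem.
Qed.

(** [A.3] gives two values of [alpha] on the arc, which excludes [QR]; the midpoint of the arc
    already has the measure center as support. *)
Lemma arc_gap j a b (E : set X) : ord0 != j -> 0 <= a -> a < b -> b <= 1 ->
  (forall x, limit_measures T x = arc j a b -> BRsharp T x -> ~ QR T x ->
     measure_center T x = S ord0 `|` S j -> E x) ->
  (c%:E <= htop T (E `&` (irregular_set T alpha `&` Tran T)))%E.
Proof.
move=> j0 a0 ab b1 KE.
have [m [n [Km Kn mn]]] := arc_two_values j0 a0 ab b1.
apply: (gap_of_measures _ _ _ _ Km Kn mn); first by exists m.
- exact: segment_image_compact.
- exact: segment_image_connected.
- exact: arc_on_segments.
move=> x xK xB; apply: KE => //.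
  move=> [p xp]; apply: mn; move: Km Kn; rewrite -xK xp.
  by move=> -> ->.
rewrite /measure_center xK.
have [p Kp sp] := arc_midpoint j a0 ab b1.
rewrite -[RHS](_ : closure (S ord0 `|` S j) = _); last first.
  by apply/esym/closure_id/closedU; exact: closed_supp.
congr closure; apply/seteqP; split => [y [q Kq]|y Sy].
  exact: (arc_supp_sub a0 b1 Kq).
by exists p => //; rewrite sp.
Qed.

(** The arcs meet at [mu ord0], so their union is connected. A measure on one arc misses the support
    belonging to the other, whereas the center contains all three supports; this excludes
    [Vsharp]. *)
Lemma two_arcs_gap i j a (E : set X) : ord0 != i -> ord0 != j -> i != j ->
  0 <= a -> a < 1 ->
  (forall x, limit_measures T x = arc i a 1 `|` arc j a 1 -> BRsharp T x ->
     ~ Vsharp T x -> E x) ->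
  (c%:E <= htop T (E `&` (irregular_set T alpha `&` Tran T)))%E.
Proof.
move=> i0 j0 ij a0 a1 KE; set K := _ `|` _ in KE.
have [m [n [Km Kn mn]]] := arc_two_values i0 a0 a1 (lexx 1).
have K1 l : arc l a 1 (mu ord0).
  by rewrite -(segment1 (mu ord0) (mu l)); apply: arc_mem; rewrite lexx ltW.
apply: (@gap_of_measures K m n) => //.
- by exists m; left.
- by apply: compactU; exact: segment_image_compact.
- by apply: connectedU; [exists (mu ord0)| |]; rewrite ?/setI//;
    exact: segment_image_connected.
- by move=> p []; exact: arc_on_segments.
- by left.
- by left.
move=> x xK xB; apply: KE => // -[_ [p]]; rewrite xK => Kp sp.
have sub l : (l == i) || (l == j) -> S l `<=` supp p.
  move=> lij y Sy; rewrite sp; apply: subset_closure; rewrite xK.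
  have l0 : arc l a 1 `<=` K.
    by move=> q Kq; case/orP: lij => /eqP e; rewrite e in Kq; [left|right].
  have [q Kq sq] := arc_midpoint l a0 a1 (lexx 1).
  by exists q; [exact: l0|rewrite sq; right].
case: Kp => Kp.
  have [y Sy] := S0 j.
  have [] := arc_supp_sub a0 (lexx 1) Kp (sub j _ y Sy).
  - by rewrite eqxx orbT.
  - by move=> S0y; exact: (Sdisj j0 S0y).
  - by move=> Siy; exact: (Sdisj ij Siy).
have [y Sy] := S0 i.
have [] := arc_supp_sub a0 (lexx 1) Kp (sub i _ y Sy).
- by rewrite eqxx.
- by move=> S0y; exact: (Sdisj i0 S0y).
- exact: (Sdisj ij Sy).
Qed.

Let i1 : 'I_3 := Ordinal (isT : (1 < 3)%N).
Let i2 : 'I_3 := Ordinal (isT : (2 < 3)%N).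

(** Strictly inside the segment all supports coincide; any closed nondegenerate interval inside
    [(0, 1)] would serve. *)
Lemma Wsharp_gap : (c%:E <= htop T ((BR1 T `\` QR T) `&`
  (irregular_set T alpha `&` Tran T)))%E.
Proof.
have h0 : 0 <= 1/3 :> R by lra.
have h1 : 1/3 < 2/3 :> R by lra.
have h2 : 2/3 <= 1 :> R by lra.
apply: (@arc_gap i1 (1/3) (2/3) _ isT h0 h1 h2).
move=> x xK xB nq mc; split => //; split => // m; rewrite xK mc => -[r + <-].
by rewrite /= in_itv/= => /andP[r0 r1]; apply: supp_segment; lra.
Qed.

(** Every measure of this half keeps the support of [mu ord0], but the end [mu ord0] itself misses
    that of [mu i1]. *)
Lemma Vsharp_Ssharp_gap : (c%:E <= htop T ((BR2 T `\` BR1 T) `&`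
  (irregular_set T alpha `&` Tran T)))%E.
Proof.
have h0 : 0 < 1/2 :> R by lra.
have h1 : 1/2 < 1 :> R by lra.
apply: (@arc_gap i1 (1/2) 1 _ isT (ltW h0) h1 (lexx 1)).
move=> x xK xB nq mc; split; first split.
- split => //; have [p Kp sp] := arc_midpoint i1 (ltW h0) h1 (lexx 1).
  by exists p; rewrite ?xK ?mc.
- have [z Sz] := S0 ord0; exists z => m; rewrite xK => Km.
  exact: (arc_supp0 h0 (lexx 1) Km).
move=> [_ /(_ (mu ord0))]; rewrite xK mc => h.
have K0 : arc i1 (1/2) 1 (mu ord0).
  by rewrite -(segment1 (mu ord0) (mu i1)); apply: arc_mem; rewrite lexx ltW.
have [z Sz] := S0 i1.
by apply: (@Sdisj i1 ord0 z) => //; rewrite /S h//; right.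
Qed.

(** The two ends have disjoint supports, which excludes [Ssharp]. *)
Lemma Vsharp_gap : (c%:E <= htop T ((BR3 T `\` BR2 T) `&`
  (irregular_set T alpha `&` Tran T)))%E.
Proof.
apply: (@arc_gap i1 0 1 _ isT (lexx 0) ltr01 (lexx 1)).
move=> x xK xB nq mc; split.
  split => //; have [p Kp sp] := arc_midpoint i1 (lexx 0) (@ltr01 R) (lexx 1).
  by exists p; rewrite ?xK ?mc.
move=> [_ [z zK]]; apply: (@Sdisj ord0 i1 z) => //; apply: zK; rewrite xK.
  by rewrite -(segment1 (mu ord0) (mu i1)); apply: arc_mem; rewrite lexx ler01.
by rewrite -(segment0 (mu ord0) (mu i1)); apply: arc_mem; rewrite lexx ler01.
Qed.

Lemma Ssharp_gap : (c%:E <= htop T ((BR4 T `\` BR3 T) `&`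
  (irregular_set T alpha `&` Tran T)))%E.
Proof.
have h0 : 0 < 1/2 :> R by lra.
have h1 : 1/2 < 1 :> R by lra.
apply: (@two_arcs_gap i1 i2 (1/2) _ isT isT isT (ltW h0) h1).
move=> x xK xB nV; split => //; right; split => //.
have [z Sz] := S0 ord0; exists z => m; rewrite xK => -[] Km;
  exact: (arc_supp0 h0 (lexx 1) Km).
Qed.

(** A single full arc already has ends with disjoint supports, which excludes [Ssharp]; the second
    arc excludes [Vsharp]. *)
Lemma BRsharp_gap : (c%:E <= htop T ((BR5 T `\` BR4 T) `&`
  (irregular_set T alpha `&` Tran T)))%E.
Proof.
apply: (@two_arcs_gap i1 i2 0 _ isT isT isT (lexx 0) ltr01).
move=> x xK xB nV; split => // -[//|[_ [z zK]]].
apply: (@Sdisj ord0 i1 z) => //; apply: zK; rewrite xK; left.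
  by rewrite -(segment1 (mu ord0) (mu i1)); apply: arc_mem; rewrite lexx ler01.
by rewrite -(segment0 (mu ord0) (mu i1)); apply: arc_mem; rewrite lexx ler01.
Qed.

End gaps.

Theorem theorem3 (R : realType) (X : pointedMetricType R) (T : X -> X)
    (compactX : compact [set: X]) (contT : continuous T)
    (satT : transitively_convex_saturated T) (denseT : entropy_dense T)
    (alpha : bprob X -> R)
    (cont_alpha : {within invariant_measures T, continuous alpha})
    (A3 : conditionA3 T alpha)
    (int_alpha : interior (alpha_range T alpha) !=set0)
    (full : exists2 mu : bprob X, invariant_measures T mu & supp mu = [set: X]) :
  full_entropy_gaps T
    [:: QR T; BR1 T; BR2 T; BR3 T; BR4 T; BR5 T]
    (irregular_set T alpha `&` Tran T).
Proof.
split; first by [].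
move=> i i5; set Y := _ `&` Tran T; set E := _ `\` _.
apply/eqP; rewrite eq_le; apply/andP; split; first by apply: le_htop; exact: subIsetr.
rewrite leNgt; apply/negP => EY.
(* A real number strictly between the two entropies, the larger of which may be infinite. *)
have [c [c0 Ec cY]] : exists c, [/\ 0 <= c, (htop T (E `&` Y) < c%:E)%E &
    (c%:E < htop T Y)%E].
  move: EY (htop_ge0 T (E `&` Y)).
  case: (htop T (E `&` Y)) => [h| |]//; case: (htop T Y) => [h'| |]//.
    rewrite lte_fin !lee_fin => hh h0; exists ((h + h') / 2).
    by rewrite !lte_fin; split; lra.
  by rewrite lee_fin => _ h0; exists (h + 1); rewrite lte_fin ltry; split; lra.
have cX : (c%:E < htop T setT)%E.
  by apply: lt_le_trans cY _; apply: le_htop; exact: subsetT.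
have [L [mu [k [P [invL disjL muL ainj [partP entP]]]]]] :=
  three_measures compactX contT denseT cont_alpha A3 int_alpha c0 cX.
move: Ec; rewrite ltNge => /negP; apply.
move: i5 @E {EY}; case: i => [|[|[|[|[|i]]]]] i5 E; rewrite /E /=.
- exact: (Wsharp_gap compactX contT satT cont_alpha A3 full invL disjL muL ainj partP entP).
- exact: (Vsharp_Ssharp_gap compactX contT satT cont_alpha A3 full invL disjL muL ainj partP entP).
- exact: (Vsharp_gap compactX contT satT cont_alpha A3 full invL disjL muL ainj partP entP).
- exact: (Ssharp_gap compactX contT satT cont_alpha A3 full invL disjL muL ainj partP entP).
- exact: (BRsharp_gap compactX contT satT cont_alpha A3 full invL disjL muL ainj partP entP).
- case: (notF i5).
Qed.
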